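(* Let $m\ge 4$ be a positive integer. For each $\theta\in(\frac{2\pi}{m},\frac{2\pi}{m-1})$, let $K_\theta\in\mathcal{P}(m,3)$ and $A_\theta\in\pi(K_\theta)$ be the cone and matrix defined in the context. (i) If $K\in\mathcal{P}(m,3)$ is an exp-maximal polyhedral cone and $A$ is an exp-maximal $K$-primitive matrix with spectral radius $\rho(A)=1$, then there exists a unique $\theta\in(\frac{2\pi}{m},\frac{2\pi}{m-1})$ such that $A\in\pi(K)$ is cone-equivalent to $A_\theta\in\pi(K_\theta)$. (ii) When $m\ge 6$, for each $\theta\in(\frac{2\pi}{m},\frac{2\pi}{m-1})$, $A_\theta$ is, up to positive scalar multiples, the only exp-maximal $K_\theta$-primitive matrix.
   Context: A proper cone $K$ in $\mathbb{R}^n$ is a closed convex cone that is pointed ($K\cap(-K)=\{0\}$) and has nonempty interior. A polyhedral cone is a proper cone with finitely many extreme rays; $\mathcal{P}(m,n)$ is the set of $n$-dimensional polyhedral cones with exactly $m$ extreme rays. $\pi(K)$ is the set of real matrices $A$ with $AK\subseteq K$. $A\in\pi(K)$ is $K$-primitive if $A^p(K\setminus\{0\})\subseteq\operatorname{int}K$ for some positive integer $p$; the least such $p$ is the exponent $\gamma(A)$. For polyhedral $K$, $\gamma(K)=\max\{\gamma(A):A\text{ is }K\text{-primitive}\}$. A $K$-primitive matrix $A$ is exp-maximal if $\gamma(A)=\gamma(K)$. A cone $K_0\in\mathcal{P}(m,n)$ is exp-maximal if $\gamma(K_0)=\max\{\gamma(K):K\in\mathcal{P}(m,n)\}$. Cone-preserving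 maps $A_1\in\pi(K_1)$ and $A_2\in\pi(K_2)$ are cone-equivalent if there is a linear isomorphism $P$ with $PK_2=K_1$ and $P^{-1}A_1P=A_2$. For $\theta\in(\frac{2\pi}{m},\frac{2\pi}{m-1})$, let $r_\theta$ be the unique positive real root of $g_\theta(t)=\frac{\sin(m-1)\theta}{\sin\theta}t^m-\frac{\sin m\theta}{\sin\theta}t^{m-1}+1$. $K_\theta$ is the polyhedral cone in $\mathbb{R}^3$ generated by the vectors $x_j(\theta)=(r_\theta^{j-1}\cos(j-1)\theta,\ r_\theta^{j-1}\sin(j-1)\theta,\ 1)^T$, $j=1,\ldots,m$, and $A_\theta=r_\theta\begin{bmatrix}\cos\theta&-\sin\theta\\ \sin\theta&\cos\theta\end{bmatrix}\oplus[1]$. It is known that $K_\theta\in\mathcal{P}(m,3)$ is exp-maximal and $A_\theta$ is an exp-maximal $K_\theta$-primitive matrix. *)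

(* Defs.v *)
From HB Require Import structures.
From mathcomp Require Import all_boot all_order all_algebra.
From mathcomp Require Import complex.
From mathcomp Require Import all_classical all_reals all_analysis.

Set Implicit Arguments.
Unset Strict Implicit.
Unset Printing Implicit Defensive.

Import Order.TTheory GRing.Theory Num.Theory.
Import numFieldNormedType.Exports.

Local Open Scope classical_set_scope.
Local Open Scope ring_scope.

Section Cones.
Context {R : realType} {n : nat}.
Implicit Types (K : set 'cV[R]_n) (A : 'M[R]_n).

Definition convex_cone K : Prop :=
  (forall (a : R) x, 0 <= a -> K x -> K (a *: x)) /\
  (forall x y, K x -> K y -> K (x + y)).

Definition pointed_cone K : Prop := K `&` [set - x | x in K] = [set 0].

Definition proper_cone K : Prop :=
  [/\ closed K, convex_cone K, pointed_cone K & K° !=set0].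

Definition ray (x : 'cV[R]_n) : set 'cV[R]_n :=
  [set a *: x | a in [set a : R | 0 <= a]].

Definition extreme_vector K (x : 'cV[R]_n) : Prop :=
  [/\ K x, x <> 0 &
      forall y z, K y -> K z -> x = y + z -> ray x y /\ ray x z].

Definition extreme_rays K : set (set 'cV[R]_n) :=
  [set ray x | x in extreme_vector K].

Definition cone_preserving K : set 'M[R]_n :=
  [set A | forall x, K x -> K (A *m x)].

Definition power_into_interior K A (p : nat) : Prop :=
  (0 < p)%N /\ forall x, K x -> x <> 0 -> K° ((A ^+ p) *m x).

Definition primitive K A : Prop :=
  cone_preserving K A /\ exists p, power_into_interior K A p.

(* gamma(A), gamma(K) and rho(A) are an attained minimum, an attained maximum
   and an attained maximum; they are given as relations with their value, so
   that no default value is needed. *)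
Definition is_exponent K A (p : nat) : Prop :=
  [/\ primitive K A, power_into_interior K A p &
      forall q, power_into_interior K A q -> (p <= q)%N].

Definition is_cone_exponent K (g : nat) : Prop :=
  (exists A, is_exponent K A g) /\
  (forall A p, is_exponent K A p -> (p <= g)%N).

Definition is_spectral_radius A (rho : R) : Prop :=
  let AC := map_mx (real_complex R) A in
  (exists2 l : R[i], eigenvalue AC l & `|l| = real_complex R rho) /\
  (forall l : R[i], eigenvalue AC l -> `|l| <= real_complex R rho).

Definition exp_maximal_matrix K A : Prop :=
  exists2 g, is_cone_exponent K g & is_exponent K A g.

(* The linear isomorphism is the invertible matrix P. *)
Definition cone_equivalent K1 A1 K2 A2 : Prop :=
  [/\ cone_preserving K1 A1, cone_preserving K2 A2 &
      exists P : 'M[R]_n, [/\ P \in unitmx, [set P *m x | x in K2] = K1 &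
                             invmx P *m A1 *m P = A2]].

End Cones.

Definition polyhedral_cones (R : realType) (m n : nat) :
    set (set 'cV[R]_n) :=
  [set K | proper_cone K /\ (extreme_rays K #= `I_m)%card].

Definition exp_maximal_cone (R : realType) (m n : nat) (K0 : set 'cV[R]_n) :
    Prop :=
  polyhedral_cones m K0 /\
  exists2 g, is_cone_exponent K0 g &
    forall K g', @polyhedral_cones R m n K -> is_cone_exponent K g' ->
      (g' <= g)%N.

Section ConeTheta.
Context {R : realType}.
Variables (m : nat) (theta : R).

Definition g_theta (t : R) : R :=
  sin (m.-1%:R * theta) / sin theta * t ^+ m
  - sin (m%:R * theta) / sin theta * t ^+ m.-1 + 1.

(* The positive root exists and is unique when
   2 pi / m < theta < 2 pi / (m - 1) and m >= 4; the default 0 is never used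
   there. *)
Definition r_theta : R := xget 0 [set t | 0 < t /\ g_theta t = 0].

(* Indices start at 0: x_theta j is the generator number j + 1. *)
Definition x_theta (j : nat) : 'cV[R]_3 :=
  \col_(i < 3) [:: r_theta ^+ j * cos (j%:R * theta);
                   r_theta ^+ j * sin (j%:R * theta);
                   1]`_i.

Definition K_theta : set 'cV[R]_3 :=
  [set x | exists2 c : 'I_m -> R, (forall j, 0 <= c j) &
             x = \sum_(j < m) c j *: x_theta j].

Definition rotation : 'M[R]_2 :=
  \matrix_(i < 2, j < 2)
    (nth [::] [:: [:: cos theta; - sin theta];
                  [:: sin theta;   cos theta]] i)`_j.

Definition A_theta : 'M[R]_3 :=
  (block_mx (r_theta *: rotation) 0 0 (1%:M : 'M[R]_1) : 'M[R]_(2 + 1)).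

End ConeTheta.

(* Main.v *)
Require Import Defs.
From HB Require Import structures.
From mathcomp Require Import all_boot all_order all_algebra.
From mathcomp Require Import complex.
From mathcomp Require Import all_classical all_reals all_analysis.
From mathcomp Require Import ring lra zify.

Set Implicit Arguments.
Unset Strict Implicit.
Unset Printing Implicit Defensive.

Import Order.TTheory GRing.Theory Num.Theory.
Import numFieldNormedType.Exports.

Local Open Scope classical_set_scope.
Local Open Scope ring_scope.

(* Call z below y when z lies in the face of K generated by y.  For a
   K-primitive A and x in K, Cayley-Hamilton makes x + A x + A^2 x interior;
   applied to A^s it shows that A^(2 s) x is interior as soon as x is below
   A^s x.  Following a walk in the digraph of A on the m extreme rays until it
   first repeats bounds the exponent by 2 m - 1, with equality only for
   Wielandt's digraph: the extreme rays are z, A z, ..., A^(m-1) z, and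
   A^m z = a z + b A z with a, b > 0 is on an edge.  K_theta attains the bound.

   Let v be the Perron vector, A v = v, and write
   A^j z = al_j z + be_j A z + ga_j v.  Since z and A z span an edge,
   ga_j > 0 for 1 < j < m, so al_j and be_j are not both nonnegative (A^j z
   would be interior), whereas al_m = a and be_m = b are positive.  The two
   sequences satisfy a linear recurrence of order two; these signs force its
   roots to be r e^(+-i theta), and the multiples of theta to pass 2 pi exactly
   between m - 1 and m.  Finally g_theta r = 0 is the relation a + b = 1.

   For (ii), A and A_theta both move the vertices of the m-gon K_theta along
   its boundary, in the same or in opposite directions, with one exception
   each.  So A_theta^-1 A or A A_theta has m - 2 >= 4 of the vertices as
   eigenvectors and is a scalar matrix; the second case is impossible because
   the vertex x_(m-1) would be a proper combination of A x_0 and A x_1. *)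

(** * Faces of closed convex cones *)

Section ConeGeometry.
Context {R : realType} {n : nat}.
Implicit Types (K : set 'cV[R]_n.+1) (x y z w : 'cV[R]_n.+1).

Lemma open_line (U : set 'cV[R]_n.+1) p w : open U -> U p ->
  exists2 e : R, 0 < e & forall s : R, `|s| < e -> U (p + s *: w).
Proof.
move=> oU Up.
have fcont : (fun s : R => p + s *: w) @ (0 : R) --> p + (0 : R) *: w.
  apply: cvgD; first exact: cvg_cst.
  by apply: cvgZr_tmp; exact: cvg_id.
have /fcont : nbhs (p + (0 : R) *: w) U.
  by rewrite scale0r addr0; exact: open_nbhs_nbhs.
move=> /nbhs_ballP[e /= e0 He]; exists e => // s se.
by apply: He; rewrite /ball /= sub0r normrN.
Qed.

Lemma interior_add K x y : convex_cone K -> K° x -> K y -> K° (x + y).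
Proof.
move=> [_ KD] Kx Ky.
have fcont : (fun z : 'cV[R]_n.+1 => z - y) @ nbhs (x + y) --> x + y - y.
  by apply: (@cvgD _ _ _ _ _ id (cst (- y))); [exact: cvg_id | exact: cvg_cst].
have : nbhs (x + y - y) K by rewrite addrK.
move=> /fcont; apply: (@filterS _ (nbhs _) (nbhs_filter _)) => z /= Kz.
by rewrite -(subrK y z); exact: KD.
Qed.

Lemma interior_scale K (a : R) x : convex_cone K -> 0 < a -> K° x -> K° (a *: x).
Proof.
move=> [KZ _] a0 Kx.
have fcont : (fun z : 'cV[R]_n.+1 => a^-1 *: z) @ nbhs (a *: x) --> a^-1 *: (a *: x).
  by apply: (@cvgZl_tmp _ _ _ _ (nbhs_filter _) _ id); exact: cvg_id.
have : nbhs (a^-1 *: (a *: x)) K by rewrite scalerA mulVf ?scale1r// gt_eqF.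
move=> /fcont; apply: (@filterS _ (nbhs _) (nbhs_filter _)) => z /= Kz.
rewrite -(scale1r z) -(@mulfV _ a) ?gt_eqF// -scalerA.
by apply: KZ => //; exact: ltW.
Qed.

(* z lies in the face of K generated by y *)
Definition below K z y : Prop := exists2 e : R, 0 < e & K (y - e *: z).

Lemma below_refl K x : convex_cone K -> K x -> below K x x.
Proof.
move=> [KZ _] Kx; exists 1 => //.
by rewrite scale1r subrr -(scale0r x); exact: KZ.
Qed.

Lemma below_add K z y w : convex_cone K -> below K z y -> K w ->
  below K z (y + w).
Proof.
by move=> [_ KD] [e e0 Ky] Kw; exists e => //; rewrite addrAC; exact: KD.
Qed.

Lemma below_trans K z y w : convex_cone K ->
  below K z y -> below K y w -> below K z w.
Proof.
move=> [KZ KD] [e e0 Ky] [d d0 Kw]; exists (d * e); first exact: mulr_gt0.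
have -> : w - (d * e) *: z = (w - d *: y) + d *: (y - e *: z).
  by rewrite scalerBr scalerA addrA subrK.
by apply: KD => //; apply: KZ => //; exact: ltW.
Qed.

Lemma below_scalel K (a : R) z y : 0 < a -> below K z y -> below K (a *: z) y.
Proof.
move=> a0 [e e0 Ky]; exists (e / a); first exact: divr_gt0.
by rewrite scalerA divfK ?gt_eqF.
Qed.

Lemma below_scaler K (a : R) z y : convex_cone K -> 0 < a ->
  below K z y -> below K z (a *: y).
Proof.
move=> [KZ _] a0 [e e0 Ky]; exists (a * e); first exact: mulr_gt0.
by rewrite -scalerA -scalerBr; apply: KZ => //; exact: ltW.
Qed.

Lemma below_addl K z w y : convex_cone K ->
  below K z y -> below K w y -> below K (z + w) y.
Proof.
(* With weights [d / (e + d)] and [e / (e + d)] the two given differences average to [y] minus this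
   multiple of [z + w]. *)
move=> [KZ KD] [e e0 Kz] [d d0 Kw]; exists (e * d / (e + d)).
  by rewrite divr_gt0 ?mulr_gt0 ?addr_gt0.
have ed0 : e + d != 0 by rewrite gt_eqF ?addr_gt0.
have -> : y - (e * d / (e + d)) *: (z + w) =
    (d / (e + d)) *: (y - e *: z) + (e / (e + d)) *: (y - d *: w).
  apply/matrixP => i j; rewrite !mxE; field.
  by rewrite ed0.
by apply: KD; apply: KZ => //; rewrite divr_ge0 ?addr_ge0 ?ltW.
Qed.

Lemma below_oppl K z y : convex_cone K -> K z -> K y -> below K (- z) y.
Proof.
move=> [KZ KD] Kz Ky; exists 1 => //.
by rewrite scale1r opprK; exact: KD.
Qed.

Lemma below0 K y : K y -> below K 0 y.
Proof. by move=> Ky; exists 1 => //; rewrite scaler0 subr0. Qed.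

(** Negative scalars are allowed because [- z] is below every [y] of [K]. Combinations with
    coefficients of unknown sign, as in Cayley-Hamilton, can thus be dominated. *)
Lemma below_scale K (a : R) z y : convex_cone K -> K z -> K y ->
  below K z y -> below K (a *: z) y.
Proof.
move=> cK Kz Ky zy; have [a0|a0|->] := ltrgtP a 0; last first.
- by rewrite scale0r; exact: below0.
- exact: below_scalel.
- rewrite -[a]opprK scaleNr; apply: below_oppl => //.
  by apply: (proj1 cK) => //; rewrite oppr_ge0 ltW.
Qed.

Lemma below_sum K (I : Type) (r : seq I) (P : pred I) (c : I -> R) f y :
  convex_cone K -> K y -> (forall i, K (f i)) -> (forall i, below K (f i) y) ->
  below K (\sum_(i <- r | P i) c i *: f i) y.
Proof.
move=> cK Ky Kf fy; elim/big_ind : _ => [|z w|i _]; first exact: below0.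
- exact: below_addl.
- exact: below_scale.
Qed.

Lemma below_interior K z y : convex_cone K -> K° z -> below K z y -> K° y.
Proof.
move=> cK Kz [e e0 Ky]; rewrite -[y](subrKC (e *: z)) addrC.
by rewrite addrC; apply: interior_add => //; exact: interior_scale.
Qed.

Lemma interior_below K z y : K° y -> below K z y.
Proof.
move=> Ky; have [e e0 He] := open_line (- z) (@open_interior _ K) Ky.
exists (e / 2); first by rewrite divr_gt0.
apply: interior_subset; rewrite -scalerN; apply: He.
by rewrite gtr0_norm ?divr_gt0// ltr_pdivrMr// ltr_pMr// ltr1n.
Qed.

Lemma map_below K (A : 'M[R]_n.+1) z y : cone_preserving K A ->
  below K z y -> below K (A *m z) (A *m y).
Proof.
move=> AK [e e0 Ky]; exists e => //.
by rewrite scalemxAr -mulmxBr; exact: AK.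
Qed.

Lemma pointed0 K x : pointed_cone K -> K x -> K (- x) -> x = 0.
Proof.
move=> pK Kx KNx; have : (K `&` [set - x | x in K]) x.
  by split => //; exists (- x) => //; rewrite opprK.
by rewrite pK.
Qed.

(** Travel from [x] along [- y]: since [- y] lies in the open complement of the pointed cone, the
    half-line leaves [K], and its last point in [K] no longer dominates [y]. *)
Lemma exit_point K x y : closed K -> convex_cone K -> pointed_cone K ->
  K x -> K y -> y <> 0 ->
  exists2 t : R, 0 <= t & K (x - t *: y) /\ ~ below K y (x - t *: y).
Proof.
move=> clK [KZ KD] pK Kx Ky y0.
have KNy : (~` K) (- y) by move=> KNy; apply: y0; exact: (pointed0 pK).
have oK : open (~` K) by exact: closed_openC.
pose S := [set t : R | 0 <= t /\ K (x - t *: y)].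
have S0 : S 0 by split => //; rewrite scale0r subr0.
have supS : has_sup S.
  split; first by exists 0.
  have [e e0 He] := open_line x oK KNy.
  (* For [t > e^-1] the point [- y + t^-1 *: x] is still outside [K], and it is a positive multiple
     of [x - t *: y]. *)
  exists (e^-1 + 1) => t [t0 Kt]; rewrite leNgt; apply/negP => et.
  have t1 : e^-1 < t by apply: lt_trans et; rewrite ltrDl.
  have tp : 0 < t by apply: lt_trans t1; rewrite invr_gt0.
  apply: (He t^-1).
    by rewrite gtr0_norm ?invr_gt0// -[e]invrK ltf_pV2// posrE invr_gt0.
  have -> : - y + t^-1 *: x = t^-1 *: (x - t *: y).
    by rewrite scalerBr scalerA mulVf ?gt_eqF// scale1r addrC.
  by apply: KZ => //; rewrite invr_ge0.
have t0 : 0 <= sup S by exact: sup_upper_bound.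
exists (sup S) => //; split.
  apply: contrapT => nK.
  have [e e0 He] := open_line y oK nK.
  have [t [t1 Kt] et] := sup_adherent e0 supS.
  have tS : t <= sup S by exact: sup_upper_bound.
  apply: (He (sup S - t)); first by rewrite ger0_norm ?subr_ge0// ltrBlDr addrC -ltrBlDr.
  by rewrite scalerBl addrA subrK.
move=> [e e0]; rewrite -addrA -opprD -scalerDl => Kt.
have : sup S + e <= sup S.
  by apply: sup_upper_bound => //; split => //; rewrite addr_ge0// ltW.
by rewrite gerDl leNgt e0.
Qed.

Lemma not_extreme K x : K x -> x <> 0 -> ~ extreme_vector K x ->
  exists y, [/\ K y, K (x - y) & ~ ray x y].
Proof.
move=> Kx x0 nE; apply: contrapT => nex; apply: nE; split => // y z Ky Kz xyz.
split; apply: contrapT => nr; apply: nex.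
  by exists y; split => //; rewrite xyz addrC addKr.
by exists z; split => //; rewrite xyz addrK.
Qed.

(* u and w span the two ends of the planar section of K through x and a
   nonproportional y of its face; each generates a smaller face than x. *)
Lemma not_extreme_split K x : closed K -> convex_cone K -> pointed_cone K ->
  K x -> x <> 0 -> ~ extreme_vector K x ->
  exists u w y (a b : R), [/\ 0 <= a, 0 <= b, x = a *: u + b *: w,
    [/\ K u, below K u x, K y, below K y x & ~ below K y u] &
    [/\ K w, below K w x & ~ below K x w]].
Proof.
move=> clK cK pK Kx x0 nE; have [KZ KD] := cK.
have [y [Ky Kxy nxy]] := not_extreme Kx x0 nE.
have y0 : y <> 0.
  by move=> y0; apply: nxy; exists 0 => //=; rewrite scale0r y0.
have [t t0 [Ku nu]] := exit_point clK cK pK Kx Ky y0.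
have [s s0 [Kw nw]] := exit_point clK cK pK Ky Kx x0.
set u := x - t *: y in Ku nu; set w := y - s *: x in Kw nw.
(* This eliminates [y]. If [1 - t * s <= 0], pointedness gives [u = 0], and [y] would be on the ray
   of [x]. *)
have xE : (1 - t * s) *: x = u + t *: w.
  by rewrite /u /w; apply/matrixP => i j; rewrite !mxE; ring.
have ts : 0 < 1 - t * s.
  rewrite ltNge; apply/negP => ts.
  have Kuw : K (u + t *: w) by apply: KD => //; exact: KZ.
  have uw0 : u + t *: w = 0.
    apply: (pointed0 pK) => //; rewrite -xE -scaleNr; apply: KZ => //.
    by rewrite oppr_ge0.
  have u0 : u = 0.
    apply: (pointed0 pK) => //; rewrite -[- u]add0r -uw0 addrAC subrr add0r.
    exact: KZ.
  have tp : 0 < t.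
    rewrite lt_def t0 andbT; apply/eqP => t0'; apply: x0.
    by rewrite -u0 /u t0' scale0r subr0.
  apply: nxy; exists t^-1 => /=; first by rewrite invr_ge0 ltW.
  have -> : x = t *: y by apply/eqP; rewrite -subr_eq0 -/u u0.
  by rewrite scalerA mulVf ?gt_eqF// scale1r.
have ux : below K u x.
  exists 1 => //; rewrite scale1r /u opprB addrC subrK; exact: KZ.
have yx : below K y x by exists 1; rewrite ?scale1r.
have wx : below K w x.
  apply: (below_trans cK _ yx); exists 1 => //.
  by rewrite scale1r /w opprB addrC subrK; exact: KZ.
exists u, w, y, (1 - t * s)^-1, ((1 - t * s)^-1 * t); split.
- by rewrite invr_ge0 ltW.
- by rewrite mulr_ge0// invr_ge0 ltW.
- by rewrite -scalerA -scalerDr -xE scalerA mulVf ?gt_eqF// scale1r.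
- by [].
- by split => // xw.
Qed.

(** Induction on the number of independent vectors in the face of [x]. A nonextreme [x] is a
    combination of [u] and [w], whose faces miss [y] and [x] respectively and so have smaller rank;
    the dimension bounds the rank. *)
Lemma krein_milman K (C : set 'cV[R]_n.+1) :
  closed K -> convex_cone K -> pointed_cone K -> convex_cone C -> C 0 ->
  extreme_vector K `<=` C -> K `<=` C.
Proof.
move=> clK cK pK [CZ CD] C0 extC.
pose face_rank k x := exists2 M : 'M[R]_(k, n.+1), row_free M &
  forall i, K (row i M)^T /\ below K (row i M)^T x.
(* A combination of vectors from the face of [u] would be below [u]; so [y], which is not, is
   independent of them. *)
have extend k x y u : K u -> K y -> below K y x -> below K u x ->
    ~ below K y u -> face_rank k u -> face_rank k.+1 x.
  move=> Ku Ky yx ux nyu [M fM HM].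
  exists (col_mx y^T M : 'M[R]_(1 + k, n.+1)).
    apply/eqP; transitivity (\rank (y^T + M)%MS); first by rewrite addsmxE.
    have cap0 : (y^T :&: M)%MS = 0.
      apply/eqP; rewrite -submx0; apply/rV_subP => v.
      rewrite sub_capmx => /andP[/sub_rVP[a ->]]; have [->|a0] := eqVneq a 0.
        by rewrite scale0r => _; rewrite sub0mx.
      rewrite eqmx_scale// => /submxP[D yD]; case: nyu.
      have -> : y = \sum_i D 0 i *: (row i M)^T.
        rewrite -[y]trmxK yD mulmx_sum_row linear_sum /=.
        by apply: eq_bigr => i _; rewrite linearZ.
      by apply: below_sum => // i; have [] := HM i.
    have := mxrank_sum_cap y^T M; rewrite cap0 mxrank0 addn0 => ->.
    rewrite (eqP fM) rank_rV; case: eqP => // yT0; case: nyu.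
    by rewrite -[y]trmxK yT0 trmx0; exact: below0.
  rewrite -[k.+1]/(1 + k)%N => i; case: (split_ordP i) => j ->.
    by rewrite rowKu row_id trmxK.
  rewrite rowKd; have [Kj ju] := HM j; split=> //.
  exact: below_trans ju ux.
have main k : forall x, K x -> ~ face_rank k x -> C x.
  elim: k => [x Kx []|k IH x Kx nr].
    by exists 0 => [|[]//]; rewrite /row_free mxrank0.
  have [->//|/eqP x0] := eqVneq x 0.
  have [/extC//|nE] := pselect (extreme_vector K x).
  have [u [w [y [a [b [a0 b0 xE [Ku ux Ky yx yu] [Kw wx xw]]]]]]] :=
    not_extreme_split clK cK pK Kx x0 nE.
  rewrite xE; apply: CD; apply: CZ => //; apply: IH => // fr; apply: nr.
    exact: (extend _ x y u).
  exact: (extend _ x x w) Kw Kx (below_refl cK Kx) wx xw fr.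
move=> x Kx; apply: (main n.+2) => // -[M fM _].
by have := rank_leq_col M; rewrite (eqP fM) ltnn.
Qed.
End ConeGeometry.

(** * Frames of extreme rays and primitive matrices *)

Section Frames.
Context {R : realType} {n : nat}.
Implicit Types (K : set 'cV[R]_n.+1) (x y z w : 'cV[R]_n.+1) (A : 'M[R]_n.+1).

Definition frame m K (x : 'I_m -> 'cV[R]_n.+1) : Prop :=
  [/\ forall i, extreme_vector K (x i),
      forall i j, ray (x i) (x j) -> i = j &
      forall z, K z -> exists2 c : 'I_m -> R, (forall i, 0 <= c i) &
        z = \sum_i c i *: x i].

Lemma extreme_ray_eq K x y : extreme_vector K x -> extreme_vector K y ->
  ray x y -> ray x = ray y.
Proof.
move=> [_ x0 _] [_ y0 _] [a /= a0 axy].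
have a1 : 0 < a.
  by rewrite lt_def a0 andbT; apply/eqP => a1; apply: y0; rewrite -axy a1 scale0r.
apply/seteqP; split => z /= [b /= b0 <-].
  exists (b / a); first by rewrite /= divr_ge0.
  by rewrite -axy scalerA divfK ?gt_eqF.
by exists (b * a); [rewrite /= mulr_ge0|rewrite -axy scalerA].
Qed.

Lemma polyhedral_frame m K : polyhedral_cones m K ->
  exists x : 'I_m -> 'cV[R]_n.+1, frame K x.
Proof.
move=> [[clK cK pK _]]; rewrite card_eq_sym => /card_set_bijP[f [fI finj fsurj]].
have /choice[x Hx] : forall i : 'I_m, exists x, extreme_vector K x /\ ray x = f i.
  by move=> i; have [x ex <-] := fI i (ltn_ord i); exists x.
have Kx i : K (x i) by have [[]] := Hx i.
exists x; split => [i|i j rij|]; first by have [] := Hx i.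
  apply: val_inj; apply: finj; rewrite ?inE /= ?ltn_ord//.
  have [[ei <-] [ej <-]] := (Hx i, Hx j); exact: extreme_ray_eq ei ej rij.
apply: (krein_milman clK cK pK).
- split=> [a z a0 [c c0 ->]|z w [c c0 ->] [d d0 ->]].
    exists (fun i => a * c i) => [i|]; first by rewrite mulr_ge0.
    by rewrite scaler_sumr; apply: eq_bigr => i _; rewrite scalerA.
  exists (fun i => c i + d i) => [i|]; first by rewrite addr_ge0.
  by rewrite -big_split; apply: eq_bigr => i _; rewrite scalerDl.
- exists (fun=> 0) => //; rewrite big1// => i _; exact: scale0r.
- move=> z ez; have [i im fi] : [set f i | i in `I_m] (ray z).
    by apply: fsurj; exists z.
  have [exi rxi] := Hx (Ordinal im).
  have : ray (x (Ordinal im)) z.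
    by rewrite rxi /= fi; exists 1 => //=; rewrite scale1r.
  move=> [a /= a0 <-]; exists (fun j => if j == Ordinal im then a else 0) => [j|].
    by case: ifP.
  rewrite (bigD1 (Ordinal im))//= eqxx big1 ?addr0// => j /negbTE ->.
  exact: scale0r.
Qed.

Lemma convex_sum K (I : Type) (r : seq I) (P : pred I) (c : I -> R) f :
  convex_cone K -> K 0 -> (forall i, 0 <= c i) -> (forall i, K (f i)) ->
  K (\sum_(i <- r | P i) c i *: f i).
Proof.
move=> [KZ KD] K0 c0 Kf; elim/big_ind : _ => // i _; exact: KZ.
Qed.

Section FrameTheory.
Variables (m : nat) (K : set 'cV[R]_n.+1) (x : 'I_m -> 'cV[R]_n.+1).
Hypotheses (Kproper : proper_cone K) (Kx : frame K x).

Let cK : convex_cone K. Proof. by have [] := Kproper. Qed.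

Lemma cone0 : K 0.
Proof.
have [_ _ _ [y Ky]] := Kproper.
rewrite -(scale0r y); apply: (proj1 cK) => //; exact: interior_subset Ky.
Qed.

Lemma frameK i : K (x i).
Proof. by have [/(_ i)[]] := Kx. Qed.

Lemma frame_neq0 i : x i <> 0.
Proof. by have [/(_ i)[]] := Kx. Qed.

Lemma frame_below_inj i j : below K (x i) (x j) -> i = j.
Proof.
move=> [e e0 Ke]; have [ext rinj _] := Kx; have [_ _ /(_ (e *: x i) _ _ Ke)] := ext j.
rewrite subrKC => /(_ _ erefl)[]; first by apply: (proj1 cK); [exact: ltW|exact: frameK].
move=> [a /= a0 axe] _; apply/esym/rinj; exists (e^-1 * a).
  by rewrite /= mulr_ge0// invr_ge0 ltW.
by rewrite -scalerA axe scalerA mulVf ?scale1r// gt_eqF.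
Qed.

Lemma sum_below (c : 'I_m -> R) i : (forall j, 0 <= c j) -> 0 < c i ->
  below K (x i) (\sum_j c j *: x j).
Proof.
move=> c0 ci; rewrite (bigD1 i)//=; apply: below_add => //.
  by apply: below_scaler => //; apply: below_refl => //; exact: frameK.
by apply: convex_sum => //; [exact: cone0|exact: frameK].
Qed.

(** A positive coefficient of [x i] in a representation of [z] already puts [x i] below [z], so
    every nonnegative representation is supported on [P]. *)
Lemma frame_support z (P : pred 'I_m) : K z ->
  (forall i, below K (x i) z -> P i) ->
  exists2 c : 'I_m -> R, (forall i, 0 <= c i) & z = \sum_(i | P i) c i *: x i.
Proof.
move=> Kz Pz; have [_ _ /(_ z Kz)[c c0 zE]] := Kx; exists c => //.
rewrite zE [RHS]big_mkcond; apply: eq_bigr => i _; case: ifPn => // nPi.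
suff -> : c i = 0 by rewrite scale0r.
apply/eqP; rewrite eq_le c0 andbT leNgt; apply/negP => ci.
by move/negP: nPi; apply; apply: Pz; rewrite zE; exact: sum_below.
Qed.

Lemma frame_ray z i : K z -> z <> 0 -> (forall j, below K (x j) z -> j = i) ->
  exists2 a : R, 0 < a & z = a *: x i.
Proof.
move=> Kz z0 zi; have [|c c0] := frame_support (P := pred1 i) Kz.
  by move=> j /zi ->; exact: eqxx.
rewrite big_pred1_eq => zE; exists (c i) => //.
rewrite lt_def c0 andbT; apply/eqP => ci; apply: z0.
by rewrite zE ci scale0r.
Qed.

Lemma frame_exists_below z : K z -> z <> 0 -> exists i, below K (x i) z.
Proof.
move=> Kz z0; apply: contrapT => /forallNP nz; apply: z0.
have [//|c _ ->] := frame_support (P := pred0) Kz; first by move=> i /nz.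
by rewrite big_pred0_eq.
Qed.

(** Every [x i] is below the sum, hence so is any interior point, being a combination of them. *)
Lemma frame_sum_interior : K° (\sum_i x i).
Proof.
have [_ _ _ [y Ky]] := Kproper.
have [_ _ /(_ y (interior_subset Ky))[c c0 yE]] := Kx.
apply: (below_interior cK Ky); rewrite yE; apply: below_sum => //.
- elim/big_ind : _ => [|z w Kz Kw|i _]; [exact: cone0|exact: (proj2 cK)|exact: frameK].
- exact: frameK.
- move=> i; have := sum_below (c := fun=> 1) (i := i) (fun=> ler01) ltr01.
  by under eq_bigr do rewrite scale1r.
Qed.

Lemma frame_not_interior i : (1 < m)%N -> ~ K° (x i).
Proof.
move=> m1 Ki.
have jP : exists j : 'I_m, j != i.
  have m0 : (0 < m)%N by exact: leq_trans m1.
  have [i0|i0] := eqVneq (val i) 0%N.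
    by exists (Ordinal m1); rewrite -val_eqE /= i0.
  by exists (Ordinal m0); rewrite -val_eqE /= eq_sym.
have [j /eqP ji] := jP; apply: ji; apply: frame_below_inj; exact: interior_below.
Qed.

End FrameTheory.

(** The coefficients are those of the remainder of ['X^p] modulo the characteristic polynomial. *)
Lemma cayley_hamilton_expn A p :
  exists c : 'I_n.+1 -> R, A ^+ p = \sum_i c i *: A ^+ i.
Proof.
have := congr1 (horner_mx A) (divp_eq 'X^p (char_poly A)).
rewrite rmorphD rmorphM /= Cayley_Hamilton mulr0 add0r rmorphXn /= horner_mx_X.
set r := _ %% _ => ->; exists (fun i => r`_i).
have szr : (size r <= n.+1)%N.
  rewrite -ltnS -(size_char_poly A) ltn_modp -size_poly_eq0 size_char_poly//.
have rE : r = \poly_(i < n.+1) r`_i.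
  by apply/polyP => i; rewrite coef_poly; case: ltnP => // ni; rewrite nth_default// (leq_trans szr).
rewrite [in LHS]rE poly_def linear_sum /=; apply: eq_bigr => i _.
by rewrite linearZ /= rmorphXn /= horner_mx_X.
Qed.

(* By Cayley-Hamilton, the interior point A ^ p x is dominated by the sum. *)
Lemma orbit_sum_interior K A x p : convex_cone K -> cone_preserving K A ->
  K x -> K° (A ^+ p *m x) -> K° (\sum_(i < n.+1) A ^+ i *m x).
Proof.
move=> cK AK Kx Kp.
have KA i : K (A ^+ i *m x).
  elim: i => [|i IH]; first by rewrite expr0 mul1mx.
  by rewrite exprS -mulmxE -mulmxA; exact: AK.
have K0 : K 0 by rewrite -(scale0r x); exact: (proj1 cK).
have Ksum (P : pred 'I_n.+1) : K (\sum_(i < n.+1 | P i) A ^+ i *m x).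
  by elim/big_ind : _ => [//|z w|i _]; [exact: (proj2 cK)|exact: KA].
apply: (below_interior cK Kp); have [c ->] := cayley_hamilton_expn A p.
rewrite mulmx_suml; under eq_bigr do rewrite -scalemxAl.
apply: below_sum => // i.
rewrite (bigD1 i)//=; apply: below_add => //; exact: below_refl.
Qed.

Section Primitive.
Variables (K : set 'cV[R]_n.+1) (A : 'M[R]_n.+1).
Hypotheses (Kproper : proper_cone K) (Aprim : primitive K A).

Let cK : convex_cone K. Proof. by have [] := Kproper. Qed.
Let pK : pointed_cone K. Proof. by have [] := Kproper. Qed.
Let AK : cone_preserving K A. Proof. by have [] := Aprim. Qed.

Lemma preserving_expn p x : K x -> K (A ^+ p *m x).
Proof.
move=> Kx; elim: p => [|p IH]; first by rewrite expr0 mul1mx.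
by rewrite exprS -mulmxE -mulmxA; exact: AK.
Qed.

Lemma interior_neq0 x : (exists2 z, K z & z <> 0) -> K° x -> x <> 0.
Proof.
move=> [z Kz z0] Kx x0; apply: z0; apply: (pointed0 pK) => //.
have [e e0] := interior_below z Kx; rewrite x0 add0r => Ke.
rewrite -[- z]scale1r -(@mulVf _ e) ?gt_eqF// -scalerA scalerN.
by apply: (proj1 cK) => //; rewrite invr_ge0 ltW.
Qed.

(** Being interior, [x] dominates [A ^+ p *m z]; then [A *m x] dominates [A ^+ p.+1 *m z], which is
    interior for a suitable [p]. *)
Lemma primitive_interior x : (exists2 z, K z & z <> 0) ->
  K° x -> K° (A *m x).
Proof.
move=> [z Kz z0] Kx; have [_ [p [p0 Hp]]] := Aprim; case: p p0 Hp => // p _ Hp.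
apply: below_interior (Hp z Kz z0) _ => //.
rewrite exprS -mulmxE -mulmxA; apply: map_below => //.
exact: interior_below.
Qed.

Lemma primitive_interior_expn x p q : (p <= q)%N -> (exists2 z, K z & z <> 0) ->
  K° (A ^+ p *m x) -> K° (A ^+ q *m x).
Proof.
move=> /subnK <- Knz Kp; elim: (q - p)%N => [//|k IH].
by rewrite addSn exprS -mulmxE -mulmxA; exact: primitive_interior.
Qed.

Lemma primitive_large x : K x -> x <> 0 ->
  exists p, forall q, (p <= q)%N -> K° (A ^+ q *m x).
Proof.
move=> Kx x0; have [_ [p [_ Hp]]] := Aprim; exists p => q pq.
by apply: primitive_interior_expn (Hp _ Kx x0) => //; exists x.
Qed.

Lemma primitive_expn_neq0 x p : K x -> x <> 0 -> A ^+ p *m x <> 0.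
Proof.
move=> Kx x0 px0; have [q Hq] := primitive_large Kx x0.
apply: (@interior_neq0 (A ^+ (q + p) *m x)); first by exists x.
  by apply: Hq; exact: leq_addr.
by rewrite exprD -mulmxE -mulmxA px0 mulmx0.
Qed.

(* If x is below A ^ s x then so is the whole orbit of x under A ^ s, and the
   last of n + 1 consecutive terms dominates their sum. *)
Lemma recurrent_interior x s l z : K x -> x <> 0 -> (0 < s)%N ->
  below K x (A ^+ s *m x) -> below K x (A ^+ l *m z) -> K z ->
  K° (A ^+ (l + s * n) *m z).
Proof.
move=> Kx x0 s0 xs xl Kz; set B := A ^+ s.
have BK : cone_preserving K B by move=> y; exact: preserving_expn.
have BpK p y : K y -> K (B ^+ p *m y).
  by rewrite /B -exprM; exact: preserving_expn.
have KB p : K (B ^+ p *m x) by exact: BpK.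
have step i j : (i <= j)%N -> below K (B ^+ i *m x) (B ^+ j *m x).
  move=> /subnK <-; elim: (j - i)%N => [|k IH].
    by rewrite add0n; exact: below_refl.
  apply: below_trans cK IH _; rewrite addSn exprSr -mulmxE -mulmxA -/B.
  by apply: map_below xs => y; exact: BpK.
have [p Hp] := primitive_large Kx x0.
have : K° (\sum_(i < n.+1) B ^+ i *m x).
  apply: (@orbit_sum_interior K B x p) => //; rewrite /B -exprM.
  by apply: Hp; rewrite leq_pmull.
move=> /(below_interior cK); rewrite addnC mulnC exprD -mulmxE -mulmxA; apply.
apply: (@below_trans _ _ _ _ (A ^+ (n * s) *m x)) => //; last first.
  by apply: map_below => // y; exact: preserving_expn.
elim/big_ind : _ => [|u v|i _].
- exact/below0/preserving_expn.
- exact: below_addl.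
- by rewrite mulnC exprM -/B; apply: step; rewrite -ltnS.
Qed.

End Primitive.
End Frames.

(** * The bound 2 m - 1 and its equality case *)

Section Wielandt.
Context {R : realType}.
Implicit Types (K : set 'cV[R]_3) (A : 'M[R]_3) (z : 'cV[R]_3).

Lemma frame_reindex n m (K : set 'cV[R]_n.+1) (x : 'I_m -> 'cV[R]_n.+1) (s : 'I_m -> 'I_m)
    (p : 'I_m -> R) : injective s -> (forall i, 0 < p i) -> frame K x ->
  convex_cone K -> frame K (fun i => p i *: x (s i)).
Proof.
move=> sinj p0 [ext rinj gen] [KZ KD].
have p0' i : p i != 0 by rewrite gt_eqF.
split => [i|i j [a /= a0 aE]|z Kz].
- have [Kx x0 xE] := ext (s i); split.
  + by apply: KZ => //; exact: ltW.
  + by move=> /eqP; rewrite scaler_eq0 (negbTE (p0' i)) => /eqP.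
  + have scale_ray y : ray (x (s i)) ((p i)^-1 *: y) -> ray (p i *: x (s i)) y.
      move=> [a /= a0 aE]; exists a => //=.
      by rewrite scalerA mulrC -scalerA aE scalerA mulfV// scale1r.
    have Kp y : K y -> K ((p i)^-1 *: y).
      by move=> Ky; apply: KZ => //; rewrite invr_ge0 ltW.
    move=> y w /Kp Ky /Kp Kw yw; have [|ry rw] := xE _ _ Ky Kw.
      by rewrite -scalerDr -yw scalerA mulVf// scale1r.
    by split; exact: scale_ray.
- apply: sinj; apply: rinj; exists (a * p i / p j).
    by rewrite /= divr_ge0 ?mulr_ge0//; exact: ltW.
  have -> : (a * p i / p j) *: x (s i) = (p j)^-1 *: (a *: (p i *: x (s i))).
    by rewrite !scalerA mulrC; congr (_ *: _); ring.
  by rewrite aE scalerA mulVf// scale1r.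
- have [c c0 ->] := gen z Kz; exists (fun i => c (s i) / p i) => [i|].
    by rewrite divr_ge0// ltW.
  rewrite (reindex_inj sinj); apply: eq_bigr => i _.
  by rewrite scalerA divfK.
Qed.

(* The digraph of A on extreme rays is Wielandt's: A moves the ray of A ^ k z
   to the next one, and the last ray into the interior of the edge spanned by
   the first two. *)
Definition wielandt m K A z (a b : R) : Prop :=
  [/\ 0 < a, 0 < b, A ^+ m *m z = a *: z + b *: (A *m z),
      frame K (fun k : 'I_m => A ^+ k *m z) &
      forall k : 'I_m, below K (A ^+ k *m z) (z + A *m z) -> (k <= 1)%N].

Variables (m : nat) (K : set 'cV[R]_3) (A : 'M[R]_3).
Variable x : 'I_m -> 'cV[R]_3.
Hypotheses (m3 : (2 < m)%N) (Kproper : proper_cone K) (Aprim : primitive K A).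
Hypothesis Kx : frame K x.

Let cK : convex_cone K. Proof. by have [] := Kproper. Qed.
Let AK : cone_preserving K A. Proof. by have [] := Aprim. Qed.

Let xK i : K (x i) := frameK Kx i.
Let x0 i : x i <> 0 := frame_neq0 Kx (i := i).
(** Existence of a walk of length [l] from [i] to [j] in the digraph of [A] on the extreme rays. *)
Let reach i l j := below K (x j) (A ^+ l *m x i).

Let reach_trans i l j s k : reach i l j -> reach j s k -> reach i (s + l) k.
Proof.
move=> ij jk; apply: below_trans jk _ => //.
rewrite exprD -mulmxE -mulmxA; apply: map_below ij => y.
exact: (preserving_expn Aprim).
Qed.

Let reach_refl i : reach i 0 i.
Proof. by rewrite /reach expr0 mul1mx; exact: below_refl. Qed.

Let step_ray i j : (forall k, reach i 1 k -> k = j) ->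
  exists2 a : R, 0 < a & A *m x i = a *: x j.
Proof.
move=> ij; apply: (frame_ray Kproper Kx); first exact: AK.
- by rewrite -[A]expr1; exact: (primitive_expn_neq0 Kproper Aprim).
- by move=> k; have := ij k; rewrite /reach expr1.
Qed.

(** The orbit of [x i] would consist of multiples of frame vectors, none of which is interior,
    contrary to primitivity. *)
Let no_permuted_rays (S : 'I_m -> Prop) i : S i ->
  (forall j, S j -> exists2 k, S k & forall l, reach j 1 l -> l = k) -> False.
Proof.
move=> Si HS; have [p /(_ p (leqnn p))] := primitive_large Kproper Aprim (xK i) (@x0 i).
have [j _ [c c0 ->]] : exists2 j, S j & exists2 c : R, 0 < c & A ^+ p *m x i = c *: x j.
  elim: p => [|p [j Sj [c c0 E]]].
    by exists i => //; exists 1 => //; rewrite expr0 mul1mx scale1r.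
  have [k Sk /step_ray[a a0 aE]] := HS j Sj; exists k => //.
  exists (c * a); first exact: mulr_gt0.
  by rewrite exprS -mulmxE -mulmxA E -scalemxAr aE scalerA.
move=> /(@interior_scale _ _ _ c^-1 _ cK); rewrite invr_gt0 => /(_ c0).
rewrite scalerA mulVf ?gt_eqF// scale1r.
by apply: (frame_not_interior Kproper Kx); apply: leq_trans m3.
Qed.

Section LongOrbit.
Variable i : 'I_m.
Hypothesis long : ~ K° (A ^+ (2 * m - 2) *m x i).

(** By [recurrent_interior] in dimension 3, a closed walk of length [s] at [j] makes
    [A ^+ (l + s * 2) *m x i] interior, which [long] forbids early. *)
Let cycle_bound l j s : reach i l j -> (0 < s)%N -> reach j s j ->
  (2 * m - 2 < l + 2 * s)%N.
Proof.
move=> ij s0 jj; rewrite ltnNge; apply/negP => ls; apply: long.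
apply: (primitive_interior_expn Kproper Aprim ls); first by exists (x i).
rewrite mulnC; exact: (recurrent_interior Kproper Aprim (x := x j)).
Qed.

Let walk : exists2 w : nat -> 'I_m, w 0 = i & forall k, reach (w k) 1 (w k.+1).
Proof.
have /choice[nxt Hn] : forall j, exists k, reach j 1 k.
  move=> j; apply: (frame_exists_below Kproper Kx); first exact: (preserving_expn Aprim).
  exact: (primitive_expn_neq0 Kproper Aprim).
by exists (fun k => iter k nxt i) => // k; exact: Hn.
Qed.

(** By [cycle_bound] the first [m] vertices of a walk from [i] are distinct, so they exhaust the
    rays, and an extra arc among them would close too short a cycle. Both arcs leaving [w m.-1]
    exist because otherwise [A] would permute some of the rays. *)
Lemma wielandt_digraph : exists w : nat -> 'I_m,
  [/\ w 0 = i, {in [pred k | (k < m)%N] &, injective w},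
      (forall a k, (a.+1 < m)%N -> reach (w a) 1 k -> k = w a.+1),
      (forall k, reach (w m.-1) 1 k -> k = w 0 \/ k = w 1) &
      reach (w m.-1) 1 (w 0) /\ reach (w m.-1) 1 (w 1)].
Proof.
have [w w0 we] := walk; exists w.
have wr a l : reach (w a) l (w (l + a)%N).
  elim: l => [|l IH]; first exact: reach_refl.
  by rewrite addSn -add1n; exact: reach_trans IH (we _).
have wr' a b : (a <= b)%N -> reach (w a) (b - a) (w b).
  by move=> ab; have := wr a (b - a)%N; rewrite subnK.
have ir l : reach i l (w l) by have := wr 0 l; rewrite addn0 w0.
(* With [l = a] and [s = b - a] the bound reads [2 * b - a > 2 * m - 2]. *)
have coll a b : (a < b)%N -> (b <= m)%N -> w a = w b -> b = m /\ (a <= 1)%N.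
  move=> ab bm wab; have : reach (w a) (b - a) (w a) by rewrite {2}wab; apply: wr'; exact: ltnW.
  move=> /(cycle_bound (ir a)); rewrite subn_gt0 => /(_ ab); lia.
have winj : {in [pred k | (k < m)%N] &, injective w}.
  move=> a b; rewrite !inE => am bm wab.
  have [ab|ba|//] := ltngtP a b.
    by have [bE _] := coll _ _ ab (ltnW bm) wab; rewrite bE ltnn in bm.
  by have [bE _] := coll _ _ ba (ltnW am) (esym wab); rewrite bE ltnn in am.
have sinj : injective (fun k : 'I_m => w k).
  by move=> a b /winj ab; apply: val_inj; apply: ab; rewrite inE.
have wsurj k : exists2 c, (c < m)%N & k = w c.
  have [g _ gK] := injF_bij sinj; exists (g k) => //; by rewrite gK.
have [a0 am wm] : exists2 a, (a <= 1)%N & w m = w a.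
  have [c cm wc] := wsurj (w m).
  by exists c => //; have [_] := coll c m cm (leqnn m) (esym wc).
have back a c : (a < m)%N -> (c <= a)%N -> reach (w a) 1 (w c) -> a = m.-1 /\ (c <= 1)%N.
  move=> am' ca ac; have /(cycle_bound (ir c)) := reach_trans (wr' _ _ ca) ac.
  by rewrite add1n ltnS leq0n => /(_ isT); lia.
(* According to the value of [w m], a shortcut from [w a] to [w c] gives a closed walk at [w 0] of
   length less than [m], or one at [w 1] of length less than [m - 1]. *)
have forw1 a c : (0 < a)%N -> (a < m)%N -> (c < m)%N -> (a.+1 < c)%N ->
    reach (w a) 1 (w c) -> False.
  move=> a_gt0 am' cm ac e; case: a0 am wm => [_|[_|//]] wm.
    have r : reach (w 0) (m - c + (1 + a)) (w 0).
      rewrite -{2}wm; apply: reach_trans (wr' _ _ (ltnW cm)).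
      apply: reach_trans e; have := wr' 0 a (leq0n a); by rewrite subn0.
    have := cycle_bound (ir 0) _ r; lia.
  have r : reach (w 1) (m - c + (1 + (a - 1))) (w 1).
    rewrite -{2}wm; apply: reach_trans (wr' _ _ (ltnW cm)).
    by apply: reach_trans e; exact: wr'.
  have := cycle_bound (ir 1) _ r; lia.
have last k : reach (w m.-1) 1 k -> k = w 0 \/ k = w 1.
  have [c cm ->] := wsurj k => e.
  have m1 : (m.-1 < m)%N by lia.
  have cm1 : (c <= m.-1)%N by lia.
  have [_] := back _ _ m1 cm1 e.
  by case: c cm e cm1 => [|[|]]//; [left|right].
have mid a k : (0 < a)%N -> (a.+1 < m)%N -> reach (w a) 1 k -> k = w a.+1.
  have [c cm ->] := wsurj k => a_gt0 am' e.
  have [ac|ca] := ltnP a c.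
    have [lt|lt|->//] := ltngtP a.+1 c; last by move: lt; rewrite ltnS leqNgt ac.
    by have := @forw1 a c a_gt0 (ltnW am') cm lt e.
  by have := back a c (ltnW am') ca e; lia.
(* Otherwise [A] permutes the rays of [w 1], ..., [w m.-1] cyclically. *)
have e0 : reach (w m.-1) 1 (w 0).
  apply: contrapT => ne.
  have wm1 : w m = w 1.
    have : reach (w m.-1) 1 (w m) by have := we m.-1; rewrite prednK// (leq_trans _ m3).
    by move=> /[dup] r /last[wE|//]; case: ne; rewrite -wE.
  apply: (@no_permuted_rays (fun k => exists2 a, (0 < a < m)%N & k = w a) (w 1)).
    by exists 1%N => //; rewrite /= (leq_trans _ m3).
  move=> _ [a /andP[a_gt0 am'] ->]; have [am1|am1] := eqVneq a.+1 m.
    exists (w 1); first by exists 1%N => //; rewrite /= (leq_trans _ m3).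
    have -> : a = m.-1 by rewrite -am1.
    by move=> l /[dup] r /last[lE|//]; case: ne; rewrite -lE.
  exists (w a.+1); first by exists a.+1 => //; rewrite /= ltn_neqAle am1.
  by move=> l; apply: mid => //; rewrite ltn_neqAle am1.
(* A shortcut from [w 0] is closed to a walk of length less than [m] by the arc [e0], so this vertex
   is treated only now. *)
have first_ k : reach (w 0) 1 k -> k = w 1.
  have [c cm ->] := wsurj k => e.
  case: c cm e => [|[//|c]] cm e.
    by have := back 0 0 _ _ e; lia.
  have r : reach (w 0) (1 + (m.-1 - c.+2 + 1)) (w 0).
    apply: reach_trans e0; apply: reach_trans e _; apply: wr'; lia.
  have := cycle_bound (ir 0) _ r; lia.
have all a k : (a.+1 < m)%N -> reach (w a) 1 k -> k = w a.+1.
  by case: a => [_|a]; [exact: first_|exact: mid].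
have e1 : reach (w m.-1) 1 (w 1).
  apply: contrapT => ne.
  apply: (@no_permuted_rays (fun=> True) i) => // k _.
  have [a am' ->] := wsurj k; have [am1|am1] := eqVneq a.+1 m.
    exists (w 0) => //; have -> : a = m.-1 by rewrite -am1.
    by move=> l /[dup] r /last[//|lE]; case: ne; rewrite -lE.
  by exists (w a.+1) => // l; apply: all; rewrite ltn_neqAle am1.
by split.
Qed.

Lemma wielandt_long : exists a b, wielandt m K A (x i) a b.
Proof.
have [w [w0 winj mid last [e0 e1]]] := wielandt_digraph.
have m0 : (0 < m)%N by exact: leq_trans m3.
have m1 : (1 < m)%N by exact: leq_trans m3.
have [p p0 pE] : exists2 p : nat -> R, (forall k, 0 < p k) &
    forall k, (k < m)%N -> A ^+ k *m x i = p k *: x (w k).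
  suff /choice[p Hp] : forall k, exists c : R, 0 < c /\
      ((k < m)%N -> A ^+ k *m x i = c *: x (w k)).
    by exists p => k; have [] := Hp k.
  elim=> [|k [c [c0 cE]]].
    by exists 1; split=> // _; rewrite expr0 mul1mx scale1r w0.
  have [km|km] := ltnP k.+1 m; last by exists 1; split.
  have [a a0 aE] := step_ray (fun l => mid k l km).
  exists (c * a); split=> [|_]; first exact: mulr_gt0.
  by rewrite exprS -mulmxE -mulmxA cE ?(ltnW km)// -scalemxAr aE scalerA.
have w01 : w 0 != w 1 by apply/eqP => /winj; rewrite !inE => /(_ m0 m1).
have [c c0 cE] : exists2 c : 'I_m -> R, (forall j, 0 <= c j) &
    A *m x (w m.-1) = c (w 0) *: x (w 0) + c (w 1) *: x (w 1).
  have [| |c c0 cE] := @frame_support _ _ _ _ x Kproper Kx (A *m x (w m.-1))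
    (fun k => (k == w 0) || (k == w 1)).
  - exact: AK.
  - move=> k; have := last k; rewrite /reach expr1 => H /H[|] ->; by rewrite eqxx ?orbT.
  exists c => //; rewrite cE (bigD1 (w 0)) ?eqxx//=; congr (_ + _).
  rewrite (eq_bigl (pred1 (w 1))) ?big_pred1_eq// => k /=.
  by case: eqVneq => [->|]; rewrite ?(negbTE w01) ?andbT//=; case: eqP.
have below_single (d : R) u v : 0 <= d -> below K (x u) (d *: x v) -> u = v.
  move=> d0 [e e_gt0 Ke]; apply: (frame_below_inj Kproper Kx).
  exists ((d + 1)^-1 * e); first by rewrite mulr_gt0// invr_gt0 ltr_wpDl.
  have d1 : d + 1 != 0 by rewrite gt_eqF// ltr_wpDl.
  have -> : x v - ((d + 1)^-1 * e) *: x u = (d + 1)^-1 *: ((d *: x v - e *: x u) + x v).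
    apply/matrixP => r s; rewrite !mxE; field; exact: d1.
  apply: (proj1 cK); first by rewrite invr_ge0 addr_ge0.
  exact: (proj2 cK).
have cpos0 : 0 < c (w 0).
  rewrite lt_def c0 andbT; apply/eqP => cw0.
  move: e0; rewrite /reach expr1 cE cw0 scale0r add0r.
  move=> /(below_single _ _ _ (c0 _))/eqP.
  by rewrite (negbTE w01).
have cpos1 : 0 < c (w 1).
  rewrite lt_def c0 andbT; apply/eqP => cw1.
  move: e1; rewrite /reach expr1 cE cw1 scale0r addr0.
  move=> /(below_single _ _ _ (c0 _))/esym/eqP.
  by rewrite (negbTE w01).
have Ax : A *m x i = p 1%N *: x (w 1) by rewrite -(pE 1%N m1) expr1.
have p1 : p 1%N != 0 by rewrite gt_eqF.
exists (p m.-1 * c (w 0)), (p m.-1 * c (w 1) / p 1%N); split.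
- by rewrite mulr_gt0.
- by rewrite divr_gt0 ?mulr_gt0.
- rewrite -{1}(prednK m0) exprS -mulmxE -mulmxA pE ?prednK//.
  rewrite -scalemxAr cE scalerDr !scalerA; congr (_ + _); first by rewrite w0.
  by rewrite Ax scalerA divfK.
- have -> : (fun k : 'I_m => A ^+ k *m x i) = (fun k : 'I_m => p k *: x (w k)).
    by apply/funext => k; rewrite pE.
  apply: (@frame_reindex 2 m K x (fun k : 'I_m => w k) (fun k => p k)) => //.
  by move=> a b /winj ab; apply: val_inj; apply: ab; rewrite inE.
- move=> k; rewrite pE// => kb.
  have xkb : below K (x (w k)) (x i + A *m x i).
    have := below_scalel (a := (p k)^-1) _ kb; rewrite invr_gt0 scalerA mulVf ?gt_eqF// scale1r.
    exact.
  (* The image of the last vertex dominates both [z] and [A *m z], so a vertex below their sum is a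
     successor of [w m.-1]. *)
  have : reach (w m.-1) 1 (w k).
    rewrite /reach expr1; apply: below_trans xkb _ => //; rewrite cE Ax -w0.
    apply: below_addl => //.
      apply: below_add => //; last by apply: (proj1 cK); rewrite ?ltW.
      by apply: below_scaler => //; exact: below_refl.
    apply: below_scalel => //; rewrite addrC; apply: below_add => //.
      by apply: below_scaler => //; exact: below_refl.
    by apply: (proj1 cK); rewrite ?ltW.
  by move=> /last[] /winj; rewrite !inE => /(_ (ltn_ord k)) ->.
Qed.

End LongOrbit.

Lemma wielandt_of_long z : K z -> z <> 0 -> ~ K° (A ^+ (2 * m - 2) *m z) ->
  exists i a b, wielandt m K A (x i) a b.
Proof.
move=> Kz z0 long; have [i iz] := frame_exists_below Kproper Kx Kz z0.
exists i; apply: wielandt_long => Ki; apply: long.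
apply: below_interior Ki _ => //; apply: map_below iz => y.
exact: (preserving_expn Aprim).
Qed.

(** Either [2 * m - 2] steps already suffice from [x i], or the digraph is Wielandt's. Then
    [A *m x i] is below its image [A ^+ m *m x i] under [A ^+ m.-1], and [recurrent_interior] gives
    [1 + 2 * (m - 1)] steps. *)
Lemma exponent_bound : power_into_interior K A (2 * m - 1).
Proof.
split=> [|z Kz z0]; first lia.
have [i iz] := frame_exists_below Kproper Kx Kz z0.
have Knz : exists2 z, K z & z <> 0 by exists z.
suff Ki : K° (A ^+ (2 * m - 1) *m x i).
  apply: below_interior Ki _ => //; apply: map_below iz => y.
  exact: (preserving_expn Aprim).
have [Ki|long] := pselect (K° (A ^+ (2 * m - 2) *m x i)).
  by apply: (primitive_interior_expn Kproper Aprim) Ki => //; lia.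
have [a [b [a0 b0 mE _ _]]] := wielandt_long long.
have KAx : K (A *m x i) by exact: AK.
have -> : (2 * m - 1 = 1 + m.-1 * 2)%N by lia.
apply: (recurrent_interior Kproper Aprim (x := A *m x i)) => //.
- by rewrite -[A]expr1; exact: (primitive_expn_neq0 Kproper Aprim).
- lia.
- rewrite mulmxA mulmxE -exprSr prednK ?(leq_trans _ m3)// mE addrC.
  apply: below_add => //; first by apply: below_scaler => //; exact: below_refl.
  by apply: (proj1 cK) => //; exact: ltW.
- by rewrite expr1; exact: below_refl.
Qed.

End Wielandt.

(** * Determinants of three vectors *)

Section Det3.
Context {R : realFieldType}.
Implicit Types (u v w x : 'cV[R]_3) (A : 'M[R]_3).

Lemma sum_ord3 (V : nmodType) (F : 'I_3 -> V) : \sum_i F i = F 0 + F 1 + F 2%:R.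
Proof.
rewrite !big_ord_recl big_ord0 addr0 addrA.
by congr (_ + F _ + F _); apply: val_inj.
Qed.

Lemma mulmx3E A u i : (A *m u) i 0 = A i 0 * u 0 0 + A i 1 * u 1 0 + A i 2%:R * u 2%:R 0.
Proof. by rewrite mxE sum_ord3. Qed.

Lemma ord3P (P : 'I_3 -> Prop) : P 0 -> P 1 -> P 2%:R -> forall i, P i.
Proof.
move=> P0 P1 P2 [[|[|[|//]]] im]; [move: P0|move: P1|move: P2];
  by congr (P _); apply: val_inj.
Qed.

(** Expanded as a polynomial in the coordinates so that [ring] settles its identities. *)
Definition d3 u v w : R :=
  u 0 0 * (v 1 0 * w 2%:R 0 - v 2%:R 0 * w 1 0)
  - v 0 0 * (u 1 0 * w 2%:R 0 - u 2%:R 0 * w 1 0)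
  + w 0 0 * (u 1 0 * v 2%:R 0 - u 2%:R 0 * v 1 0).

Definition cols3 u v w : 'M[R]_3 := \matrix_(i, j) [:: u; v; w]`_j i 0.

Lemma det_mx3 A : \det A =
  A 0 0 * (A 1 1 * A 2%:R 2%:R - A 2%:R 1 * A 1 2%:R)
  - A 0 1 * (A 1 0 * A 2%:R 2%:R - A 2%:R 0 * A 1 2%:R)
  + A 0 2%:R * (A 1 0 * A 2%:R 1 - A 2%:R 0 * A 1 1).
Proof.
pose f (i j : nat) := A (inord i) (inord j).
have fE i j : A i j = f i j by rewrite /f !inord_val.
rewrite (expand_det_row A 0) sum_ord3 /cofactor.
rewrite !(expand_det_row _ 0) !big_ord_recl !big_ord0 /cofactor !det_mx11 !mxE /=.
rewrite !fE /= /bump /=; ring.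
Qed.

Lemma det_cols3 u v w : \det (cols3 u v w) = d3 u v w.
Proof. by rewrite det_mx3 /d3 !mxE /=; ring. Qed.

Lemma mulmx_cols3 A u v w : A *m cols3 u v w = cols3 (A *m u) (A *m v) (A *m w).
Proof.
apply/matrixP => i; apply: ord3P; rewrite !mxE /=;
  by apply: eq_bigr => j _; rewrite !mxE.
Qed.

Lemma d3_mulmx A u v w : d3 (A *m u) (A *m v) (A *m w) = \det A * d3 u v w.
Proof. by rewrite -!det_cols3 -mulmx_cols3 det_mulmx. Qed.

Lemma cols3_mul u v w x :
  cols3 u v w *m x = x 0 0 *: u + x 1 0 *: v + x 2%:R 0 *: w.
Proof. by apply/colP => i; rewrite mulmx3E !mxE /=; ring. Qed.

Lemma cramer3 u v w x :
  d3 u v w *: x = d3 x v w *: u + d3 u x w *: v + d3 u v x *: w.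
Proof. by apply/colP; apply: ord3P; rewrite !mxE /d3; ring. Qed.

Lemma d3_free u v w (a b c : R) : d3 u v w != 0 ->
  a *: u + b *: v + c *: w = 0 -> [/\ a = 0, b = 0 & c = 0].
Proof.
move=> d0 E.
split; apply: (mulIf d0); rewrite mul0r.
- transitivity (d3 (a *: u + b *: v + c *: w) v w); last by rewrite E /d3 !mxE; ring.
  by rewrite /d3 !mxE; ring.
- transitivity (d3 u (a *: u + b *: v + c *: w) w); last by rewrite E /d3 !mxE; ring.
  by rewrite /d3 !mxE; ring.
- transitivity (d3 u v (a *: u + b *: v + c *: w)); last by rewrite E /d3 !mxE; ring.
  by rewrite /d3 !mxE; ring.
Qed.

Lemma d3_dependent u v w : d3 u v w = 0 -> exists a b c : R,
  (a, b, c) != (0, 0, 0) /\ a *: u + b *: v + c *: w = 0.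
Proof.
rewrite -det_cols3 -det_tr => /eqP/det0P[x x0 xE].
exists (x 0 0), (x 0 1), (x 0 2%:R); split.
  apply/eqP => -[a0 b0 c0]; move/eqP: x0; apply; apply/rowP.
  by apply: ord3P; rewrite mxE.
have := congr1 trmx xE; rewrite trmx_mul trmxK trmx0 cols3_mul !mxE.
by [].
Qed.

Lemma mulmx_eq3 A B u v w : d3 u v w != 0 -> A *m u = B *m u ->
  A *m v = B *m v -> A *m w = B *m w -> A = B.
Proof.
move=> d0 Eu Ev Ew; have unitP : cols3 u v w \in unitmx by rewrite unitmxE det_cols3 unitfE.
by rewrite -[A](mulmxK unitP) -[B](mulmxK unitP) !mulmx_cols3 Eu Ev Ew.
Qed.
Lemma d3Dr u v x y : d3 u v (x + y) = d3 u v x + d3 u v y.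
Proof. by rewrite /d3 !mxE; ring. Qed.

Lemma d3Zr (a : R) u v x : d3 u v (a *: x) = a * d3 u v x.
Proof. by rewrite /d3 !mxE; ring. Qed.

Lemma d3_rot u v w : d3 u v w = d3 v w u.
Proof. by rewrite /d3; ring. Qed.

Lemma d3_swap u v w : d3 u v w = - d3 u w v.
Proof. by rewrite /d3; ring. Qed.

Lemma d3_diagl u v : d3 u v u = 0.
Proof. by rewrite /d3; ring. Qed.

Lemma d3_diag u v : d3 u v v = 0.
Proof. by rewrite /d3; ring. Qed.

(** With [u] as the apex of a fan, this three-term relation passes positivity from one triangle to
    the next. *)
Lemma d3_plucker u v w x y :
  d3 u v w * d3 u x y = d3 u v x * d3 u w y + d3 u v y * d3 u x w.
Proof. by rewrite /d3; ring. Qed.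

(** Expand [A *m y] in [u], [A *m u], [y] by Cramer's rule and apply the form that sends [z] to
    [d3 u (A *m u) (A *m z)], which kills [u]. *)
Lemma d3_orbit A u y :
  d3 u y (A *m y) * d3 u (A *m u) (A *m (A *m u)) =
  d3 u (A *m u) (A *m y) ^+ 2 - d3 u (A *m u) y * d3 u (A *m u) (A *m (A *m y)).
Proof.
have := congr1 (fun z => d3 u (A *m u) (A *m z)) (cramer3 u (A *m u) y (A *m y)).
rewrite /= !mulmxDr -!scalemxAr !d3Dr !d3Zr d3_diag mulr0 add0r => ->.
have -> : d3 u (A *m y) y = - d3 u y (A *m y) by rewrite d3_swap.
ring.
Qed.

End Det3.

(** * The Perron vector of a Wielandt matrix *)

Section WielandtPerron.
Context {R : realType}.
Implicit Types (K : set 'cV[R]_3) (A : 'M[R]_3) (z v : 'cV[R]_3).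

(** In a linear relation among three extreme vectors, moving the negative terms to the other side
    either puts one vector below a multiple of another or contradicts pointedness. *)
Lemma frame_d3 m K (x : 'I_m -> 'cV[R]_3) : proper_cone K -> frame K x ->
  forall i j k, i != j -> j != k -> i != k -> d3 (x i) (x j) (x k) != 0.
Proof.
move=> Kproper Kx; have [_ cK pK _] := Kproper; have [KZ KD] := cK.
have xK := frameK Kx; have binj := frame_below_inj Kproper Kx.
have xneq0 := frame_neq0 Kx.
have KcZ (c : R) l : 0 <= c -> K (c *: x l) by move=> c0; exact: KZ.
have bel (c d : R) l l' : 0 < c -> 0 <= d -> below K (x l) (c *: x l + d *: x l').
  move=> c0 d0; apply: below_add; [exact: cK| |exact: KcZ].
  by apply: below_scaler => //; exact: below_refl.
have unscale (c : R) l l' : 0 < c -> below K (x l) (c *: x l') -> l = l'.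
  move=> c0 lb; apply: binj; rewrite -[x l']scale1r -(@mulVf _ c) ?gt_eqF// -scalerA.
  by apply: below_scaler => //; rewrite invr_gt0.
have pos (i j k : 'I_m) (a b c : R) : i != j -> j != k -> i != k -> 0 < a ->
    a *: x i + b *: x j + c *: x k = 0 -> False.
  move=> ij jk ik a0 E; have [c0|c0] := ltP c 0.
    have [b0|b0] := ltP b 0.
      have : below K (x j) (a *: x i).
        have -> : a *: x i = (- b) *: x j + (- c) *: x k.
          by apply/eqP; rewrite -subr_eq0 -E; apply/eqP/colP => l; rewrite !mxE; ring.
        by apply: bel; rewrite ?oppr_gt0// oppr_ge0 ltW.
      by move=> /unscale-/(_ a0)/eqP; rewrite eq_sym (negbTE ij).
    have : below K (x i) ((- c) *: x k).
      have -> : - c *: x k = a *: x i + b *: x j.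
        by apply/eqP; rewrite eq_sym -subr_eq0 -E; apply/eqP/colP => l; rewrite !mxE; ring.
      exact: bel.
    by move=> /unscale; rewrite oppr_gt0 => /(_ c0)/eqP; rewrite (negbTE ik).
  have [b0|b0] := ltP b 0.
    have : below K (x i) ((- b) *: x j).
      have -> : - b *: x j = a *: x i + c *: x k.
        by apply/eqP; rewrite eq_sym -subr_eq0 -E; apply/eqP/colP => l; rewrite !mxE; ring.
      exact: bel.
    by move=> /unscale; rewrite oppr_gt0 => /(_ b0)/eqP; rewrite (negbTE ij).
  have xi0 : a *: x i = 0.
    apply: (pointed0 pK); first by apply: KcZ; exact: ltW.
    have -> : - (a *: x i) = b *: x j + c *: x k.
      by apply/eqP; rewrite eq_sym -subr_eq0 -E; apply/eqP/colP => l; rewrite !mxE; ring.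
    by apply: KD; exact: KcZ.
  by move/eqP: xi0; rewrite scaler_eq0 gt_eqF//= => /eqP/xneq0.
have zero (i j k : 'I_m) (a b c : R) : i != j -> j != k -> i != k ->
    a *: x i + b *: x j + c *: x k = 0 -> a = 0.
  move=> ij jk ik E; have [a0|a0|//] := ltrgtP a 0; last by case: (pos _ _ _ _ _ _ ij jk ik a0 E).
  case: (pos _ _ _ (- a) (- b) (- c) ij jk ik); first by rewrite oppr_gt0.
  by rewrite !scaleNr -!opprD E oppr0.
move=> i j k ij jk ik; apply/eqP => /d3_dependent[a [b [c [/negP nz E]]]]; apply: nz.
have a0 := zero _ _ _ _ _ _ ij jk ik E.
have b0 : b = 0.
  apply: (zero j i k b a c) => //; first by rewrite eq_sym.
  by rewrite [b *: _ + _]addrC.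
have c0 : c = 0.
  apply: (zero k i j c a b) => //; rewrite 1?eq_sym//.
  by rewrite -addrA addrC.
by rewrite a0 b0 c0.
Qed.

Lemma pow_comb_lt (a b s t : R) n : 0 < a -> 0 < b -> 0 <= s -> s < t ->
  a * s ^+ n.+1 + b * s ^+ n < a * t ^+ n.+1 + b * t ^+ n.
Proof.
move=> a0 b0 s0 st; apply: ltr_leD.
  by rewrite ltr_pM2l// ltrXn2r.
by rewrite ler_pM2l// lerXn2r// ?nnegrE// ?ltW// (le_lt_trans s0).
Qed.

Lemma pow_comb_inj (a b s t : R) n : 0 < a -> 0 < b -> 0 < s -> 0 < t ->
  a * s ^+ n.+1 + b * s ^+ n = a * t ^+ n.+1 + b * t ^+ n -> s = t.
Proof.
move=> a0 b0 s0 t0 E; have [st|ts|//] := ltrgtP s t.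
  by have := pow_comb_lt n a0 b0 (ltW s0) st; rewrite E ltxx.
by have := pow_comb_lt n a0 b0 (ltW t0) ts; rewrite E ltxx.
Qed.

Lemma pow_comb_exists (a b : R) n : 0 < a -> 0 < b ->
  exists2 t : R, 0 < t & a * t ^+ n.+2 + b * t ^+ n.+1 = 1.
Proof.
move=> a0 b0; pose p : {poly R} := a *: 'X^(n.+2) + b *: 'X^(n.+1) - 1%:P.
have pE t : p.[t] = a * t ^+ n.+2 + b * t ^+ n.+1 - 1.
  by rewrite /p !hornerE.
(* At [1 + a^-1] the leading term alone is at least [a * (1 + a^-1) = a + 1]. *)
have hT : 1 <= 1 + a^-1 by rewrite lerDl invr_ge0 ltW.
have h0 : 0 <= 1 + a^-1 by rewrite (le_trans _ hT).
have [||t /andP[t0 _]] := @poly_ivt R p 0 (1 + a^-1) => //.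
  rewrite !pE !expr0n /= !mulr0 addr0 sub0r lerN10 /=.
  rewrite subr_ge0 -[leLHS]addr0 lerD//; last first.
    by rewrite mulr_ge0 ?exprn_ge0// ltW.
  apply: (@le_trans _ _ (a * (1 + a^-1))).
    by rewrite mulrDr mulr1 mulfV ?gt_eqF// lerDr ltW.
  by rewrite ler_pM2l// exprS ler_peMr// exprn_ege1.
rewrite /root pE subr_eq0 => /eqP E; exists t => //.
rewrite lt_def t0 andbT; apply/eqP => t0'; move: E.
by rewrite t0' !expr0n /= !mulr0 addr0 => /esym/eqP; rewrite oner_eq0.
Qed.

(** Put [B = t *: A]; then [B ^+ m *m z] is [a * t ^+ m] times [z] plus [b * t ^+ m.-1] times
    [B *m z], with coefficients of sum 1. Hence [B] fixes [a * t ^+ m] times [z] plus the sum of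
    [B ^+ k *m z] over [0 < k < m], which is interior because every frame vector occurs in it. *)
Lemma wielandt_eigenvector m K A z a b : (1 < m)%N -> proper_cone K ->
  wielandt m K A z a b ->
  exists2 t : R, 0 < t /\ a * t ^+ m + b * t ^+ m.-1 = 1 &
    exists2 v, K° v & t *: (A *m v) = v.
Proof.
case: m => [//|[//|n]] _ Kproper [a0 b0 AE Kx _].
have [t t0 tE] := pow_comb_exists n a0 b0; exists t => //.
have [_ cK _ _] := Kproper.
pose c k := if k == 0%N then a * t ^+ n.+2 else t ^+ k.
have c0 k : 0 < c k by rewrite /c; case: ifP => _; [apply: mulr_gt0 => //|]; exact: exprn_gt0.
exists (\sum_(k < n.+2) c k *: (A ^+ k *m z)).
  apply: (below_interior cK (frame_sum_interior Kproper Kx)).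
  have KX := frameK Kx.
  rewrite (_ : \sum_i _ = \sum_(i < n.+2) 1 *: (A ^+ i *m z)); last first.
    by apply: eq_bigr => i _; rewrite scale1r.
  apply: below_sum => // [|i].
    by apply: convex_sum => // [|i]; [exact: cone0 Kproper|exact: ltW].
  by apply: (sum_below Kproper Kx (c := fun i : 'I_n.+2 => c i)) => // j; exact: ltW.
rewrite big_ord_recl -(big_mkord xpredT (fun k => c k.+1 *: (A ^+ k.+1 *m z))).
rewrite [X in X + _]/= /c /= expr0 mul1mx.
rewrite mulmxDr scalerDr mulmx_sumr scaler_sumr.
rewrite (eq_bigr (fun k => t ^+ k.+2 *: (A ^+ k.+2 *m z))); last first.
  by move=> k _; rewrite -scalemxAr scalerA -exprS mulmxA mulmxE -exprS.
rewrite big_nat_recr//= [in RHS]big_nat_recl//= AE expr1.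
set S := \sum_(0 <= i < n) _.
apply/colP => i; rewrite -scalemxAr !mxE.
set u := z i 0; set w := \sum_j _; set s := S i 0.
apply/eqP; rewrite -subr_eq0; apply/eqP.
transitivity ((a * t ^+ n.+2 + b * t ^+ n.+1 - 1) * t * w); last first.
  by rewrite tE subrr !mul0r.
rewrite !exprS; ring.
Qed.

Lemma wielandt_scale m K A z a b t : (1 < m)%N -> proper_cone K -> 0 < t ->
  wielandt m K A z a b ->
  wielandt m K (t *: A) z (a * t ^+ m) (b * t ^+ m.-1).
Proof.
case: m => [//|m] m1 Kproper t0 [a0 b0 AE Kx adj].
have [_ cK _ _] := Kproper.
have tX k : (t *: A) ^+ k *m z = t ^+ k *: (A ^+ k *m z).
  by rewrite exprZn scalemxAl.
have Kz : K z by have := frameK Kx ord0; rewrite expr0 mul1mx.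
have KAz : K (A *m z) by have := frameK Kx (Ordinal m1); rewrite expr1.
split.
- by rewrite mulr_gt0 ?exprn_gt0.
- by rewrite mulr_gt0 ?exprn_gt0.
- rewrite tX AE scalerDr !scalerA -scalemxAl scalerA [in LHS]mulrC.
  by congr (_ + _ *: _); rewrite /= exprS; ring.
- have -> : (fun k : 'I_m.+1 => (t *: A) ^+ k *m z) = (fun k : 'I_m.+1 => t ^+ k *: (A ^+ k *m z)).
    by apply/funext => k; rewrite tX.
  apply: (@frame_reindex R 2 m.+1 K (fun k => A ^+ k *m z) id (fun k => t ^+ k)) => // k.
  exact: exprn_gt0.
- move=> k; rewrite tX => kb; apply: adj.
  apply: (@below_trans _ _ _ _ (z + (t *: A) *m z)) => //.
    have := below_scalel (a := (t ^+ k)^-1) _ kb.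
    by rewrite invr_gt0 exprn_gt0// scalerA mulVf ?gt_eqF ?exprn_gt0// scale1r; apply.
  have zz : below K z (z + A *m z) by apply: below_add => //; exact: below_refl.
  have Az : below K (A *m z) (z + A *m z).
    by rewrite addrC; apply: below_add => //; exact: below_refl.
  by apply: below_addl => //; rewrite -scalemxAl; exact: below_scalel.
Qed.

(** Both sides of the matrix equation commute with [A] and agree on [z], hence on the basis [z],
    [A *m z], [A ^+ 2 *m z]. *)
Lemma wielandt_powE m K A z a b : (2 < m)%N -> proper_cone K ->
  wielandt m K A z a b -> d3 z (A *m z) (A ^+ 2 *m z) != 0 /\
  A ^+ m = b *: A + a *: 1.
Proof.
move=> m3 Kproper [a0 b0 AE Kx _].
pose o k (km : (k < 3)%N) : 'I_m := Ordinal (leq_trans km m3).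
have d0 : d3 z (A *m z) (A ^+ 2 *m z) != 0.
  have := frame_d3 Kproper Kx (i := @o 0%N isT) (j := @o 1%N isT) (k := @o 2%N isT) isT isT isT.
  by rewrite /= expr0 expr1 mul1mx.
split=> //.
have comm k : A ^+ m *m (A ^+ k *m z) = (b *: A + a *: 1) *m (A ^+ k *m z).
  rewrite mulmxA mulmxE -exprD addnC exprD -mulmxE -mulmxA AE.
  rewrite mulmxDr mulmxDl -!scalemxAl -!scalemxAr !mulmxA [1 *m _]mul1mx addrC.
  by rewrite !mulmxE -exprS -exprSr.
apply: (mulmx_eq3 d0); first by have := comm 0%N; rewrite expr0 mul1mx.
  by have := comm 1%N; rewrite expr1.
exact: comm.
Qed.

(** An eigenvalue [l] of modulus 1 satisfies [l ^+ m = b * l + a], so [1 <= a + b]. The eigenvalue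
    [t^-1] of the interior eigenvector is at most 1, so [1 <= t]. Since [a * t ^+ m + b * t ^+ m.-1]
    increases with [t] and equals 1, both are equalities. *)
Lemma wielandt_spectral_radius m K A z a b : (2 < m)%N -> proper_cone K ->
  wielandt m K A z a b -> is_spectral_radius A 1 ->
  a + b = 1 /\ exists2 v, K° v & A *m v = v.
Proof.
move=> m3 Kproper W [[l lev l1] max1].
have [a0 b0 _ Kx _] := W; have [_ AmE] := wielandt_powE m3 Kproper W.
have m1 : (1 < m)%N by exact: ltnW.
have [t [t0 tE] [v Kv Av]] := wielandt_eigenvector m1 Kproper W.
pose f := real_complex R.
have ab1 : 1 <= a + b.
  have [u uE u0] := eigenvalueP lev.
  have uX k : u *m map_mx f (A ^+ k) = l ^+ k *: u.
    elim: k => [|k IH]; first by rewrite !expr0 map_mx1 mulmx1 scale1r.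
    by rewrite exprSr -mulmxE map_mxM mulmxA IH -scalemxAl uE scalerA -exprSr.
  have lE : l ^+ m = f b * l + f a.
    have : (l ^+ m) *: u = (f b * l + f a) *: u.
      rewrite -uX AmE map_mxD !map_mxZ mulmxDr -!scalemxAr uE map_mx1 mulmx1.
      by rewrite scalerA -scalerDl.
    move=> /eqP; rewrite -subr_eq0 -scalerBl scaler_eq0 (negbTE u0) orbF subr_eq0.
    by move=> /eqP.
  have : `|l ^+ m| <= `|f b * l| + `|f a| by rewrite lE ler_normD.
  rewrite normrX normrM l1 expr1n mulr1.
  have fn (r : R) : 0 < r -> `|f r| = f r.
    by move=> r0; rewrite ger0_norm// /f ler0c ltW.
  by rewrite !fn// -rmorphD lecR addrC.
have t1 : 1 <= t.
  have v0 : v != 0.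
    apply/eqP/(interior_neq0 Kproper) => //.
    exists z; first by have := frameK Kx (Ordinal (ltnW m1)); rewrite expr0 mul1mx.
    by have := frame_neq0 Kx (i := Ordinal (ltnW m1)); rewrite expr0 mul1mx.
  have Av' : A *m v = t^-1 *: v by rewrite -[in RHS]Av scalerA mulVf ?gt_eqF// scale1r.
  have ev : eigenvalue A t^-1.
    have : \det (A - (t^-1)%:M)^T == 0.
      apply/det0P; exists v^T.
        by apply/eqP => /(congr1 trmx); rewrite trmxK trmx0; exact/eqP.
      by rewrite -trmx_mul mulmxBl Av' mul_scalar_mx subrr trmx0.
    rewrite det_tr => /det0P[u u0 uE]; apply/eigenvalueP; exists u => //.
    by apply/eqP; rewrite -subr_eq0 -mul_mx_scalar -mulmxBr uE.
  have [u uE u0] := eigenvalueP ev.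
  have /max1 : eigenvalue (map_mx f A) (f t^-1).
    apply/eigenvalueP; exists (map_mx f u); first by rewrite -map_mxM uE map_mxZ.
    by rewrite map_mx_eq0.
  rewrite ger0_norm; last by rewrite /f ler0c invr_ge0 ltW.
  by rewrite lecR invf_le1.
have t1E : t = 1.
  apply/eqP; rewrite eq_le t1 andbT leNgt; apply/negP => lt1t.
  have := pow_comb_lt m.-1 a0 b0 ler01 lt1t.
  rewrite !expr1n !mulr1 prednK ?tE; last exact: ltnW.
  by rewrite ltNge ab1.
split; first by rewrite t1E !expr1n !mulr1 in tE.
by exists v => //; rewrite t1E scale1r in Av.
Qed.
End WielandtPerron.

(** * Classification by the angle theta *)

Section Lucas.
Context {R : realType}.
Implicit Types (s d r theta x : R).

(** The Lucas sequence of [x^2 - s x + d]. For [j > 0] the coefficients [al_j] and [be_j] of the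
    overview are [- d * lucas s d j.-1] and [lucas s d j]. *)
Fixpoint lucas s d n : R :=
  if n is n1.+1 then if n1 is n2.+1 then s * lucas s d n1 - d * lucas s d n2 else 1
  else 0.

Lemma lucasSS s d n : lucas s d n.+2 = s * lucas s d n.+1 - d * lucas s d n.
Proof. by []. Qed.

(** Binet's formula for the roots [r e^(+-i theta)]. *)
Lemma lucas_sin r theta n : sin theta != 0 ->
  lucas (2 * r * cos theta) (r ^+ 2) n.+1 = r ^+ n * sin (n.+1%:R * theta) / sin theta.
Proof.
move=> s0; suff : lucas (2 * r * cos theta) (r ^+ 2) n.+1 = r ^+ n * sin (n.+1%:R * theta) / sin theta /\
  lucas (2 * r * cos theta) (r ^+ 2) n.+2 = r ^+ n.+1 * sin (n.+2%:R * theta) / sin theta by case.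
elim: n => [|n [IH1 IH2]]; last split=> //.
  rewrite lucasSS /= expr0 !mul1r expr1 mulr1 mulr0 subr0 divff//; split=> //.
  rewrite (_ : 2%:R * theta = theta + theta); last by rewrite mulr2n mulrDl mul1r.
  rewrite sinD; field; exact: s0.
rewrite lucasSS IH1 IH2.
have -> : n.+3%:R * theta = n.+2%:R * theta + theta by rewrite -[n.+3%:R]natr1; ring.
have -> : n.+1%:R * theta = n.+2%:R * theta - theta by rewrite -[n.+2%:R]natr1; ring.
by rewrite sinB sinD !exprS; field; exact: s0.
Qed.

(* With a nonnegative discriminant, s, d > 0 makes the sequence positive,
   d < 0 <= s makes the second index fail, s < 0 < d the third, and s, d < 0
   makes the sequence alternate. *)
Lemma lucas_discriminant_lt0 m s d : (4 <= m)%N ->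
  (forall j, (1 < j)%N -> (j < m)%N ->
     ~ (0 <= - d * lucas s d j.-1 /\ 0 <= lucas s d j)) ->
  0 < - d * lucas s d m.-1 -> 0 < lucas s d m -> s ^+ 2 < 4 * d.
Proof.
move=> m4 npos am bm; rewrite ltNge; apply/negP => disc.
case: m m4 npos am bm => [//|[//|m]] m4 npos; rewrite /= -/(lucas s d m.+1) => am bm.
have [d0|d0|d0] := ltrgtP d 0; last by rewrite d0 oppr0 mul0r ltxx in am.
  have n2 : s < 0.
    rewrite ltNge; apply/negP => s0; apply: (npos 2) => //=; first exact: leq_trans m4.
    by rewrite !mulr1 mulr0 subr0 oppr_ge0 ltW.
  have alt j : lucas s d j.+1 * lucas s d j.+2 < 0.
    elim: j => [|j IH]; first by rewrite /= mul1r mulr1 mulr0 subr0.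
    have j20 : 0 < lucas s d j.+2 ^+ 2.
      by rewrite lt_def sqr_ge0 sqrf_eq0 andbT; apply: contraTneq IH => ->; rewrite mulr0 ltxx.
    rewrite lucasSS mulrBr; set u := lucas s d j.+1 in IH *; set w := lucas s d j.+2 in IH j20 *.
    have duw : 0 < d * (u * w) by rewrite nmulr_rgt0.
    have sww : s * w ^+ 2 < 0 by rewrite nmulr_rlt0.
    have -> : w * (s * w) - w * (d * u) = s * w ^+ 2 - d * (u * w) by ring.
    lra.
  have := alt m; rewrite ltNge => /negP; apply; rewrite mulr_ge0// ltW//.
  by rewrite -(@pmulr_rgt0 _ (- d)) ?oppr_gt0.
have s0 : 0 < s.
  rewrite ltNge; apply/negP => s0; apply: (npos 3) => //=.
  rewrite !mulr1 mulr0 subr0; split; nra.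
have pos j : 0 < lucas s d j.+1 /\ s / 2 * lucas s d j.+1 <= lucas s d j.+2.
  elim: j => [|j [IH1 IH2]].
    by rewrite /= mulr1 mulr0 subr0 mulr1; split; lra.
  have j2 : 0 < lucas s d j.+2 by apply: lt_le_trans IH2; nra.
  split=> //; rewrite (lucasSS s d j.+1).
  set u := lucas s d j.+1 in IH1 IH2 *; set w := lucas s d j.+2 in IH2 j2 *.
  have : s * u <= 2 * w by lra.
  have : 4 * d * u <= s ^+ 2 * u by rewrite ler_pM2r.
  have : s * (s * u) <= s * (2 * w) by rewrite ler_pM2l//; lra.
  rewrite mulrA -expr2; lra.
by have [] := pos m; move: am; set u := lucas s d m.+1; nra.
Qed.

Lemma sin_lt0_2pi x : pi < x < 2 * pi -> sin x < 0.
Proof.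
move=> xpi; rewrite -[x](subrK pi) sinDpi oppr_lt0 sin_gt0_pi//; lra.
Qed.

Lemma sin_le0_2pi x : pi <= x <= 2 * pi -> sin x <= 0.
Proof.
move=> xpi; rewrite -[x](subrK pi) sinDpi oppr_le0 sin_ge0_pi//; lra.
Qed.

Lemma sin_gt0_3pi x : 2 * pi < x < 3 * pi -> 0 < sin x.
Proof.
move=> xpi; rewrite -[x](subrK (pi *+ 2)) sinD2pi sin_gt0_pi//; lra.
Qed.

Lemma sin_ge0_3pi x : 2 * pi <= x <= 3 * pi -> 0 <= sin x.
Proof.
move=> xpi; rewrite -[x](subrK (pi *+ 2)) sinD2pi sin_ge0_pi//; lra.
Qed.

Definition window m theta : Prop :=
  [/\ 0 < theta < pi, m.-1%:R * theta < 2 * pi & 2 * pi < m%:R * theta].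

Lemma windowP m theta : (4 <= m)%N ->
  (theta \in `]2 * pi / m%:R, 2 * pi / m.-1%:R[) <-> window m theta.
Proof.
case: m => [//|m] m4; have pi0 := pi_gt0 R.
have m0 : 0 < m%:R :> R by rewrite ltr0n; lia.
rewrite in_itv /= ltr_pdivrMr// ltr_pdivlMr// [theta * _]mulrC [theta * m%:R]mulrC.
split=> [/andP[t1 t2]|[_ -> ->]//]; split=> //.
(* After the case split [m] stands for the former [m - 1]; that it is at least 3 gives
   [theta < pi]. *)
have m3 : 3 <= m%:R :> R by rewrite ler_nat.
have t0 : 0 < theta by rewrite -(@pmulr_rgt0 _ m.+1%:R)// (lt_trans _ t1)// mulr_gt0.
by rewrite t0 /=; nra.
Qed.

Section Window.
Variables (m : nat) (theta : R).
Hypotheses (m4 : (4 <= m)%N) (tw : window m theta).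

Lemma window_sin_gt0 : 0 < sin theta.
Proof. by have [t0 _ _] := tw; exact: sin_gt0_pi. Qed.

Let mE : m%:R = m.-1%:R + 1 :> R.
Proof. by rewrite natr1 prednK// (leq_trans _ m4). Qed.

Lemma window_sin_pred_lt0 : sin (m.-1%:R * theta) < 0.
Proof.
have [/andP[t0 t1] t2] := tw; rewrite mE mulrDl mul1r => t3.
apply: sin_lt0_2pi; lra.
Qed.

Lemma window_sin_mul_gt0 : 0 < sin (m%:R * theta).
Proof.
have [/andP[t0 t1] t2 t3] := tw; apply: sin_gt0_3pi; rewrite t3 mE mulrDl mul1r /=; lra.
Qed.

Let ca : 0 < - sin (m.-1%:R * theta) / sin theta.
Proof. by rewrite divr_gt0 ?window_sin_gt0// oppr_gt0 window_sin_pred_lt0. Qed.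

Let cb : 0 < sin (m%:R * theta) / sin theta.
Proof. by rewrite divr_gt0 ?window_sin_gt0// window_sin_mul_gt0. Qed.

Let g_thetaE t : (g_theta m theta t = 0) <->
  - sin (m.-1%:R * theta) / sin theta * t ^+ m
  + sin (m%:R * theta) / sin theta * t ^+ m.-1 = 1.
Proof. rewrite /g_theta; split; lra. Qed.

(** By the signs of the sines, [g_theta] vanishes where a positive combination of [t ^+ m] and
    [t ^+ m.-1] equals 1, and that combination is strictly increasing for [t > 0]. *)
Lemma r_theta_unique t : 0 < t -> g_theta m theta t = 0 -> t = r_theta m theta.
Proof.
move=> t0 tE; apply/esym; rewrite /r_theta.
apply: xget_unique => // u [u0 /g_thetaE uE]; move/g_thetaE: tE => tE.
have := @pow_comb_inj R _ _ u t m.-1 ca cb u0 t0.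
by rewrite prednK ?(leq_trans _ m4)// => -> //; rewrite uE tE.
Qed.

Lemma r_thetaP : 0 < r_theta m theta /\ g_theta m theta (r_theta m theta) = 0.
Proof.
have [t t0] := pow_comb_exists (m - 2) ca cb.
have [-> ->] : (m - 2).+2 = m /\ (m - 2).+1 = m.-1 by lia.
by move=> /g_thetaE gt; rewrite -(r_theta_unique t0 gt).
Qed.

End Window.

(* Otherwise the first multiple of theta past 2 pi is a forbidden index j. *)
Lemma windowI m theta : (4 <= m)%N -> 0 < theta < pi ->
  (forall j, (1 < j)%N -> (j < m)%N ->
     ~ (sin (j.-1%:R * theta) <= 0 /\ 0 <= sin (j%:R * theta))) ->
  sin (m.-1%:R * theta) < 0 -> 0 < sin (m%:R * theta) -> window m theta.
Proof.
move=> m4 /andP[t0 t1] npos sm1 sm.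
have mE : m%:R = m.-1%:R + 1 :> R by rewrite natr1 prednK// (leq_trans _ m4).
have m0 : 0 <= m.-1%:R * theta by rewrite mulr_ge0// ltW.
have lt2pi : m.-1%:R * theta < 2 * pi.
  rewrite ltNge; apply/negP => ge2pi.
  have ex : exists j, 2 * pi <= j%:R * theta by exists m.-1.
  case: (ex_minnP ex) => j jge jmin.
  have jm : (j < m)%N by rewrite -ltnS -(prednK (leq_trans _ m4 : 0 < m)%N)// !ltnS jmin.
  case: j jge jmin jm => [|j] jge jmin jm; first by rewrite mul0r in jge; have := pi_gt0 R; lra.
  have jlt : j%:R * theta < 2 * pi.
    by rewrite ltNge; apply/negP => /jmin; rewrite ltnn.
  rewrite -[j.+1%:R]natr1 mulrDl mul1r in jge.
  have j0 : (0 < j)%N.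
    rewrite lt0n; apply/eqP => j0; rewrite j0 in jge.
    by have := pi_gt0 R; lra.
  apply: (npos j.+1) => //=; split; first by apply: ltW; apply: sin_lt0_2pi; lra.
  by apply: sin_ge0_3pi; rewrite -[j.+1%:R]natr1 mulrDl mul1r; lra.
have gtpi : pi < m.-1%:R * theta.
  rewrite ltNge; apply/negP => lepi.
  by have := sin_ge0_pi (x := m.-1%:R * theta); rewrite m0 lepi leNgt sm1 => /(_ isT).
split=> //; first by rewrite t0.
rewrite ltNge; apply/negP => le2pi; have : sin (m%:R * theta) <= 0.
  apply: sin_le0_2pi; rewrite le2pi mE mulrDl mul1r andbT; lra.
by rewrite leNgt sm.
Qed.

End Lucas.

Section Classification.
Context {R : realType}.
Implicit Types (K : set 'cV[R]_3) (A : 'M[R]_3) (z v : 'cV[R]_3) (theta : R).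

Lemma A_thetaE m theta : A_theta m theta = cols3
  (\col_i [:: r_theta m theta * cos theta; r_theta m theta * sin theta; 0]`_i)
  (\col_i [:: - (r_theta m theta * sin theta); r_theta m theta * cos theta; 0]`_i)
  (\col_i [:: 0; 0; 1]`_i).
Proof.
apply/matrixP; apply: ord3P; apply: ord3P; rewrite !mxE;
  case: splitP => -[[|[|k]] km]//= _; rewrite !mxE;
  case: splitP => -[[|[|l]] lm]//= _; rewrite !mxE//=; ring.
Qed.

Lemma mul_cols3_mx (u v w : 'cV[R]_3) A : cols3 u v w *m A =
  cols3 (cols3 u v w *m col 0 A) (cols3 u v w *m col 1 A) (cols3 u v w *m col 2%:R A).
Proof.
apply/matrixP => i; apply: ord3P; rewrite !mxE /=;
  by apply: eq_bigr => j _; rewrite !mxE.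
Qed.

Lemma x_theta0 m theta : x_theta m theta 0 = \col_i [:: 1; 0; 1]`_i.
Proof.
by apply/colP; apply: ord3P; rewrite !mxE /= ?expr0 ?mul0r ?cos0 ?sin0 ?mul1r.
Qed.

Lemma x_thetaS m theta k : x_theta m theta k.+1 = A_theta m theta *m x_theta m theta k.
Proof.
have kE : k.+1%:R * theta = k%:R * theta + theta by rewrite -natr1; ring.
apply/colP; apply: ord3P; rewrite A_thetaE mulmx3E !mxE /= ?kE ?cosD ?sinD ?exprS; ring.
Qed.

Lemma d3_lincomb (u v w : 'cV[R]_3) (a c e : R) :
  d3 (u - a *: w) (c *: (v - a *: w - e *: (u - a *: w))) (a *: w) = c * a * d3 u v w.
Proof. by rewrite /d3 !mxE; ring. Qed.

Lemma wielandt_theta m K A z a b v : (4 <= m)%N -> proper_cone K ->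
  wielandt m K A z a b -> K° v -> A *m v = v ->
  exists2 theta, window m theta & exists P : 'M[R]_3,
    [/\ P \in unitmx, A *m P = P *m A_theta m theta &
        forall k, P *m x_theta m theta k = A ^+ k *m z].
Proof.
move=> m4 Kproper W Kv Av.
have [_ cK _ _] := Kproper; have [KZ KD] := cK.
have m3 : (2 < m)%N by exact: ltnW.
have m1 : (1 < m)%N by exact: ltnW.
have m0 : (0 < m)%N by exact: ltnW.
have [a0 b0 AE Kx adj] := W; have [dD _] := wielandt_powE m3 Kproper W.
set w := A *m z in AE adj dD *.
have KX k (km : (k < m)%N) : K (A ^+ k *m z) := frameK Kx (Ordinal km).
have Kz : K z by have := KX 0%N m0; rewrite expr0 mul1mx.
have Kw : K w by have := KX 1%N m1; rewrite expr1.
have Kv' : K v by exact: interior_subset.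
have Kzw : K (z + w) by exact: KD.
have zzw : below K z (z + w) by apply: below_add => //; exact: below_refl.
have wzw : below K w (z + w) by rewrite addrC; apply: below_add => //; exact: below_refl.
have span_below (c e : R) : below K (c *: z + e *: w) (z + w).
  by apply: below_addl => //; exact: below_scale.
have notadj k : (1 < k)%N -> (k < m)%N -> ~ below K (A ^+ k *m z) (z + w).
  by move=> k1 km /(adj (Ordinal km)); rewrite leqNgt k1.
(* If [v] lay in the plane of [z] and [w], it would be below [z + w]; then [z + w] would be interior
   and dominate [A ^+ 2 *m z]. *)
have D0 : d3 z w v != 0.
  apply/eqP => D0; have := cramer3 z w (A ^+ 2 *m z) v.
  rewrite D0 scale0r addr0 => vE.
  have vzw : below K v (z + w).
    rewrite -[v]scale1r -(mulVf dD) -scalerA vE scalerDr !scalerA; exact: span_below.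
  apply: (@notadj 2%N) => //; apply: interior_below.
  exact: below_interior Kv vzw.
have [s [d [g A2]]] : exists s d g, A ^+ 2 *m z = s *: w - d *: z + g *: v.
  have E := cramer3 z w v (A ^+ 2 *m z).
  exists (d3 z (A ^+ 2 *m z) v / d3 z w v), (- (d3 (A ^+ 2 *m z) w v / d3 z w v)),
    (d3 z w (A ^+ 2 *m z) / d3 z w v).
  rewrite -[LHS]scale1r -(mulVf D0) -scalerA E !scalerDr !scalerA scaleNr opprK.
  by rewrite [_ *: z + _]addrC ![_^-1 * _]mulrC.
have A2' : A *m w = s *: w - d *: z + g *: v by rewrite -A2 expr2 -mulmxE -mulmxA.
pose U := lucas s d.
(* This is the coordinate [ga_j] along [v]: each step adds [g] times the coordinate along [w]. *)
pose h := fix h j : R := if j is i.+1 then h i + g * U i else 0.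
have hS j : h j.+1 = h j + g * U j by [].
have orb j : A ^+ j.+1 *m z = (- d * U j) *: z + U j.+1 *: w + h j.+1 *: v.
  elim: j => [|j IH].
    by rewrite expr1 /U /= !mulr0 addr0 !scale0r scale1r add0r addr0.
  rewrite exprS -mulmxE -mulmxA IH !mulmxDr -!scalemxAr Av A2' (hS j.+1).
  rewrite (_ : U j.+2 = s * U j.+1 - d * U j) -/w//.
  by apply/colP => i; rewrite !mxE; ring.
(* Closed form of the partial sums; at index [m], where [h] vanishes, it will yield [a + b = 1]. *)
have hU j : (1 - s + d) * h j.+1 = g * (1 - U j.+1 + d * U j).
  elim: j => [|j IH]; first by rewrite /h /U /=; ring.
  rewrite (hS j.+1) mulrDr IH (_ : U j.+2 = s * U j.+1 - d * U j)//; ring.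
have mE : m = m.-1.+1 by rewrite prednK.
have [Um1 Um hm] : [/\ - d * U m.-1 = a, U m = b & h m = 0].
  have : (- d * U m.-1 - a) *: z + (U m - b) *: w + h m *: v = 0.
    transitivity (A ^+ m *m z - (a *: z + b *: w)); last by rewrite AE subrr.
    rewrite {2 3 4}mE orb -mE; apply/colP => i; rewrite !mxE. ring.
  by move=> /(d3_free D0)[/eqP + /eqP +]; rewrite !subr_eq0 => /eqP -> /eqP ->.
(* Otherwise [A ^+ j *m z] is a vector of the span of [z] and [w] minus a vector of [K], hence below
   [z + w]. *)
have hpos j : (1 < j)%N -> (j < m)%N -> 0 < h j.
  case: j => [//|j] j1 jm; rewrite ltNge; apply/negP => hj.
  apply: (notadj j.+1) => //; rewrite orb; apply: below_addl => //.
  rewrite -[h _]opprK scaleNr; apply: below_oppl => //.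
  by apply: KZ => //; rewrite oppr_ge0.
have npos j : (1 < j)%N -> (j < m)%N -> ~ (0 <= - d * U j.-1 /\ 0 <= U j).
  case: j => [//|j] j1 jm [al be].
  apply: (frame_not_interior Kproper Kx (i := Ordinal jm) m1) => /=.
  rewrite orb addrC; apply: interior_add => //.
    by apply: interior_scale => //; exact: hpos.
  by apply: KD; exact: KZ.
have disc : s ^+ 2 < 4 * d.
  by apply: (lucas_discriminant_lt0 m4 npos); rewrite -/U ?Um1 ?Um.
have d0 : 0 < d by have := sqr_ge0 s; lra.
pose r := Num.sqrt d.
have r0 : 0 < r by rewrite sqrtr_gt0.
have r2 : r ^+ 2 = d by rewrite sqr_sqrtr// ltW.
have cb : -1 < s / (2 * r) < 1.
  rewrite -ltr_norml normrM normfV (ger0_norm (_ : 0 <= 2 * r)) ?mulr_ge0 ?(ltW r0)//.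
  rewrite ltr_pdivrMr ?mulr_gt0// mul1r -(@ltr_pXn2r _ 2) ?nnegrE ?normr_ge0 ?mulr_ge0 ?(ltW r0)//.
  by rewrite real_normK ?num_real// exprMn r2; lra.
pose theta := acos (s / (2 * r)).
have [cb1 cb2] := andP cb.
have costh : cos theta = s / (2 * r) by rewrite acosK// in_itv /= !ltW.
have th : 0 < theta < pi by rewrite acos_gt0 ?acos_ltpi ?cb1 ?cb2 ?(ltW cb1) ?(ltW cb2).
have sE : s = 2 * r * cos theta.
  by rewrite costh mulrC divfK// mulf_neq0// gt_eqF.
have s0 : 0 < sin theta by exact: sin_gt0_pi.
have sn0 : sin theta != 0 by rewrite gt_eqF.
have UE j : U j.+1 = r ^+ j * sin (j.+1%:R * theta) / sin theta.
  by rewrite /U sE -r2 lucas_sin.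
have dUE j : d * U j = r ^+ j.+1 * sin (j%:R * theta) / sin theta.
  case: j => [|j]; first by rewrite /U /= mul0r sin0 !mulr0 mul0r.
  by rewrite UE -r2 !exprS; field.
have sgn j (x : R) : (0 <= r ^+ j * x / sin theta) = (0 <= x).
  by rewrite pmulr_lge0 ?invr_gt0// pmulr_rge0// exprn_gt0.
have sgn' j (x : R) : (0 < r ^+ j * x / sin theta) = (0 < x).
  by rewrite pmulr_lgt0 ?invr_gt0// pmulr_rgt0// exprn_gt0.
have tw : window m theta.
  apply: windowI => //.
  - case=> [//|j] j1 jm [sj sj1]; apply: (npos j.+1) => //=; rewrite UE sgn; split=> //.
    by rewrite mulNr dUE -mulNr -mulrN sgn oppr_ge0.
  - by move: a0; rewrite -Um1 mulNr dUE -mulNr -mulrN sgn' oppr_gt0.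
  - by move: b0; rewrite -Um {1}mE UE sgn' -mE.
have g0 : 0 < g by have := hpos 2%N isT m3; rewrite /h /U /= mulr0 !add0r mulr1.
have q0 : 0 < 1 - s + d.
  have := sqr_ge0 (1 - s / 2).
  have -> : (1 - s / 2) ^+ 2 = 1 - s + s ^+ 2 / 4 by field.
  lra.
have ab1 : a + b = 1.
  have := hU m.-1; rewrite -mE hm mulr0 => /esym/eqP; rewrite mulf_eq0 gt_eqF//=.
  by move=> /eqP E; rewrite -Um1 -Um; lra.
have rE : r = r_theta m theta.
  apply: r_theta_unique => //; rewrite /g_theta.
  have := dUE m.-1; rewrite -mE => dUm; have := UE m.-1; rewrite -mE => UmE.
  have -> : sin (m.-1%:R * theta) / sin theta * r ^+ m = - a by rewrite -Um1 mulNr dUm; ring.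
  have -> : sin (m%:R * theta) / sin theta * r ^+ m.-1 = b by rewrite -Um UmE; ring.
  by rewrite -ab1; ring.
exists theta => //.
(* With this value [z - dl *: v] is the component of [z] in the invariant plane complementary to
   [v], where [A] satisfies [x^2 - s x + d = 0]. *)
pose dl := g / (1 - s + d).
have dl0 : dl != 0 by rewrite gt_eqF// divr_gt0.
have gE : g = dl * (1 - s + d) by rewrite divfK// gt_eqF.
pose p1 := z - dl *: v; pose c := (r * sin theta)^-1.
have c0 : c != 0 by rewrite invr_eq0 mulf_neq0// gt_eqF.
(* Chosen so that [A *m p1] is [r * cos theta] times [p1] plus [r * sin theta] times [p2], as for
   the first column of [A_theta]. *)
pose p2 := c *: (A *m p1 - (r * cos theta) *: p1).
have Ap1 : A *m p1 = w - dl *: v by rewrite /p1 mulmxBr -scalemxAr Av.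
pose P := cols3 p1 p2 (dl *: v).
have APE : A *m P = P *m A_theta m theta.
  rewrite mulmx_cols3 /P mul_cols3_mx A_thetaE -rE.
  rewrite !cols3_mul !mxE /= !scale0r !addr0 scale1r add0r -[A *m (dl *: v)]scalemxAr Av; congr cols3.
    apply/colP => i; rewrite !mxE -/c /c; field.
    by rewrite sn0 gt_eqF.
  rewrite /p2 -scalemxAr mulmxBr -scalemxAr Ap1 mulmxBr. rewrite -scalemxAr Av A2' /p1 gE.
  have cs : sin theta ^+ 2 = 1 - cos theta ^+ 2 by exact: sin2cos2.
  apply/colP => i; rewrite !mxE /c sE -r2; set zi := z i 0; set vi := v i 0; set wi := \sum_j _.
  apply/eqP; rewrite -subr_eq0; apply/eqP.
  transitivity (r / sin theta * (cos theta ^+ 2 + sin theta ^+ 2 - 1) * (zi - dl * vi)).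
    by field; rewrite sn0 gt_eqF.
  by rewrite cs; ring.
exists P; split => //.
  rewrite unitmxE det_cols3 unitfE.
  have -> : d3 p1 p2 (dl *: v) = c * dl * d3 z w v.
    by rewrite /p2 Ap1 /p1; exact: d3_lincomb.
  by apply: mulf_neq0 => //; exact: mulf_neq0.
elim=> [|k IH].
  rewrite expr0 mul1mx x_theta0 cols3_mul !mxE /= scale0r addr0 !scale1r.
  by rewrite /p1 subrK.
by rewrite x_thetaS mulmxA -APE -mulmxA IH mulmxA mulmxE -exprS.
Qed.
End Classification.

(** * The polygonal cone K_theta *)

Section ThetaPoints.
Context {R : realType}.
Implicit Types (u v w x y : 'cV[R]_3) (A : 'M[R]_3).

(* The increments of u have the sign of sin, so u first grows from 0 and then
   decreases towards its last value. *)
Lemma hump_gt0 m theta (q u : nat -> R) N : (4 <= m)%N -> window m theta ->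
  (forall k, 0 < q k) -> u 0%N = 0 ->
  (forall k, u k.+1 = u k + q k * sin (k.+1%:R * theta)) ->
  (N <= m.-1)%N -> 0 <= u N -> forall k, (0 < k)%N -> (k < N)%N -> 0 < u k.
Proof.
move=> m4 [/andP[t0 tpi] t2 t3] q0 u0 uS Nm uN.
have up k : k.+1%:R * theta <= pi -> 0 < u k.+1.
  elim: k => [|k IH] kpi; rewrite uS.
    by rewrite u0 add0r mulr_gt0// mul1r sin_gt0_pi// t0.
  have kS : k.+2%:R * theta = k.+1%:R * theta + theta by rewrite -[k.+2%:R]natr1; ring.
  rewrite ltr_wpDr//; last by apply: IH; lra.
  apply: mulr_ge0; first exact: ltW.
  by rewrite sin_ge0_pi// kpi andbT mulr_ge0// ltW.
have neg k : (k < m.-1)%N -> pi < k%:R * theta -> u k.+1 < u k.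
  move=> km kpi; rewrite uS gtrDl pmulr_rlt0//; apply: sin_lt0_2pi.
  have kS : k.+1%:R * theta = k%:R * theta + theta by rewrite -[k.+1%:R]natr1; ring.
  have kle : k.+1%:R * theta <= m.-1%:R * theta by rewrite ler_pM2r// ler_nat.
  lra.
have down n k : (k + n.+1 = N)%N -> pi < k%:R * theta -> 0 < u k.
  elim: n k => [|n IH] k kN kpi; (apply: le_lt_trans (neg _ _ kpi); last lia).
    by rewrite -addn1 kN.
  apply/ltW/IH; first lia.
  by apply: lt_le_trans kpi _; rewrite ler_pM2r// ler_nat.
case=> [//|k] _ kN; have [kpi|kpi] := leP (k.+1%:R * theta) pi; first exact: up.
by apply: (down (N - k.+2)%N) => //; lia.
Qed.

Section Theta.
Variables (m : nat) (theta : R).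
Hypotheses (m4 : (4 <= m)%N) (tw : window m theta).
Notation r := (r_theta m theta).
Notation X := (x_theta m theta).
Notation A := (A_theta m theta).
Notation F k := (d3 (X 0%N) (X 1%N) (X k)).
Notation E k := (d3 (X 0%N) (X k) (X k.+1)).

Let r0 : 0 < r. Proof. by have [] := r_thetaP m4 tw. Qed.
Let s0 : 0 < sin theta. Proof. exact: window_sin_gt0 tw. Qed.

(** [theta_a] and [theta_b] are [- r^2 U_(m-1)] and [U_m] for the Lucas sequence [U] with roots
    [r e^(+-i theta)]. *)
Definition theta_a : R := - r ^+ m * sin (m.-1%:R * theta) / sin theta.
Definition theta_b : R := r ^+ m.-1 * sin (m%:R * theta) / sin theta.

Lemma theta_a_gt0 : 0 < theta_a.
Proof.
rewrite /theta_a mulNr -mulrN divr_gt0// mulr_gt0 ?exprn_gt0// oppr_gt0.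
exact: window_sin_pred_lt0.
Qed.

Lemma theta_b_gt0 : 0 < theta_b.
Proof.
rewrite /theta_b divr_gt0// mulr_gt0 ?exprn_gt0//.
exact: window_sin_mul_gt0 m4 tw.
Qed.

(** The third coordinate is the equation [g_theta r = 0]; the first two are trigonometric
    identities. *)
Lemma x_theta_wrap : X m = theta_a *: X 0%N + theta_b *: X 1%N.
Proof.
have [_] := r_thetaP m4 tw; rewrite /g_theta => gr.
have m0 : (0 < m)%N by exact: leq_trans m4.
have sE : sin (m.-1%:R * theta) = sin (m%:R * theta) * cos theta - cos (m%:R * theta) * sin theta.
  by rewrite -sinB; congr sin; rewrite -[in RHS](prednK m0) -natr1; ring.
have rE : r ^+ m = r * r ^+ m.-1 by rewrite -exprS prednK.
have sn : sin theta != 0 by rewrite gt_eqF.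
apply/colP; apply: ord3P; rewrite !mxE /= ?mul1r ?mul0r ?cos0 ?sin0 ?expr0 ?expr1
  ?mulr0 ?mulr1 ?add0r /theta_a /theta_b.
- by rewrite sE rE; field.
- by rewrite rE; field.
- apply/eqP; rewrite eq_sym -subr_eq0 -oppr_eq0 -gr; apply/eqP; field.
  exact: sn.
Qed.

(** The squared distance from 1 to [r e^(i theta)]. *)
Let gam := 1 - 2 * r * cos theta + r ^+ 2.

Let gam0 : 0 < gam.
Proof.
have -> : gam = (r - cos theta) ^+ 2 + sin theta ^+ 2 by rewrite sin2cos2 /gam; ring.
by rewrite ltr_wpDl ?sqr_ge0// exprn_gt0.
Qed.

Let x_coord k : X k 2%:R 0 = 1. Proof. by rewrite mxE. Qed.

Let A_coord y : [/\ (A *m y) 0 0 = r * (cos theta * y 0 0 - sin theta * y 1 0),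
  (A *m y) 1 0 = r * (sin theta * y 0 0 + cos theta * y 1 0) &
  (A *m y) 2%:R 0 = y 2%:R 0].
Proof. by split; rewrite A_thetaE mulmx3E !mxE /=; ring. Qed.

Let x0_coord : [/\ X 0%N 0 0 = 1, X 0%N 1 0 = 0 & X 0%N 2%:R 0 = 1].
Proof. by rewrite x_theta0 !mxE. Qed.

Let FS k : F k.+1 = F k + gam * r ^+ k * sin (k%:R * theta).
Proof.
rewrite -mulrA; have -> : r ^+ k * sin (k%:R * theta) = X k 1 0 by rewrite mxE.
rewrite [X k.+1]x_thetaS [X 1%N]x_thetaS /d3 x_coord.
have [-> -> ->] := A_coord (X k); have [-> -> ->] := A_coord (X 0%N).
have [-> -> ->] := x0_coord; rewrite x_coord /gam.
have := cos2Dsin2 theta.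
set c := cos theta; set s := sin theta; set y0 := X k 0 0; set y1 := X k 1 0 => cs.
apply/eqP; rewrite -subr_eq0; apply/eqP.
transitivity (r ^+ 2 * y1 * (c ^+ 2 + s ^+ 2 - 1)); first by ring.
by rewrite cs subrr mulr0.
Qed.

Let ES k : E k.+1 = r ^+ 2 * E k + gam * (r ^+ k.+1 * sin (k.+1%:R * theta)).
Proof.
have -> : r ^+ k.+1 * sin (k.+1%:R * theta) = X k.+1 1 0 by rewrite mxE.
rewrite [X k.+2]x_thetaS [X k.+1]x_thetaS /d3.
have [-> -> ->] := A_coord (A *m X k); have [-> -> ->] := A_coord (X k).
have [-> -> ->] := x0_coord; rewrite x_coord /gam.
have := cos2Dsin2 theta.
set c := cos theta; set s := sin theta; set y0 := X k 0 0; set y1 := X k 1 0 => cs.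
apply/eqP; rewrite -subr_eq0; apply/eqP.
transitivity ((r ^+ 3 * s * (y0 ^+ 2 + y1 ^+ 2) + r ^+ 2 * y1) * (c ^+ 2 + s ^+ 2 - 1)).
  by ring.
by rewrite cs subrr mulr0.
Qed.

(** [F] is 0 at index 1, its increments have the signs of [sin (k theta)], and it is 0 again at
    index [m], where [x_theta_wrap] puts [X m] in the plane of [X 0] and [X 1]. *)
Lemma F_gt0 k : (1 < k)%N -> (k < m)%N -> 0 < F k.
Proof.
case: k => [//|k] k1 km.
apply: (@hump_gt0 m theta (fun k => gam * r ^+ k.+1) (fun k => F k.+1) m.-1) => //.
- by move=> j; rewrite mulr_gt0 ?exprn_gt0.
- exact: d3_diag.
- rewrite prednK ?(leq_trans _ m4)// x_theta_wrap d3Dr !d3Zr d3_diag mulr0 addr0.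
  by rewrite d3_diagl mulr0.
- lia.
Qed.

(** Divided by [r ^+ (2 * k)], the recurrence of [E] has the shape required by [hump_gt0]. The last
    value is positive by [d3_orbit]: as [F m = 0], it says [E (m - 2) * F 2 = F m.-1 ^+ 2]. *)
Lemma E_gt0 k : (0 < k)%N -> (k.+1 < m)%N -> 0 < E k.
Proof.
have Elast : 0 < E (m - 2).
  have := d3_orbit A (X 0%N) (X (m - 2)); rewrite -!x_thetaS.
  have -> : (m - 2).+2 = m by lia.
  have -> : (m - 2).+1 = m.-1 by lia.
  have -> : F m = 0.
    rewrite x_theta_wrap d3Dr !d3Zr d3_diag mulr0 addr0.
    by rewrite d3_diagl mulr0.
  rewrite mulr0 subr0 => EF.
  have F2 : 0 < F 2 by apply: F_gt0 => //; exact: ltnW.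
  by rewrite -(pmulr_lgt0 _ F2) EF exprn_gt0// F_gt0//; lia.
move=> k0 km; have [->//|km2] := eqVneq k (m - 2)%N.
suff : 0 < E k / r ^+ (2 * k) by rewrite pmulr_lgt0// invr_gt0 exprn_gt0.
apply: (@hump_gt0 m theta (fun k => gam / r ^+ k.+1)
  (fun k => E k / r ^+ (2 * k)) (m - 2)) => //.
- by move=> j; rewrite divr_gt0 ?exprn_gt0.
- by rewrite d3_rot d3_diagl mul0r.
- move=> j; have e2 : r ^+ (2 * j) = r ^+ j * r ^+ j by rewrite -exprD addnn mul2n.
  rewrite /= ES mulnS exprD e2 [r ^+ j.+1]exprS; field.
  have rn : r != 0 by rewrite gt_eqF.
  by rewrite ?rn ?expf_neq0.
- lia.
- by rewrite divr_ge0 ?exprn_ge0 ?ltW.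
- lia.
Qed.

(** From the apex [X 0], positivity spreads along the fan by [d3_plucker], fed with [F_gt0] and
    [E_gt0]. Powers of [A], which has positive determinant, move the apex to any [X i]. *)
Lemma theta_d3_gt0 i j k : (i < j)%N -> (j < k)%N -> (k < m)%N ->
  0 < d3 (X i) (X j) (X k).
Proof.
have D0 p q : (0 < p)%N -> (p < q)%N -> (q < m)%N -> 0 < d3 (X 0%N) (X p) (X q).
  move=> p0 pq qm; have [p1|p1] := eqVneq p 1%N.
    by rewrite p1 in pq *; exact: F_gt0.
  have Fp : 0 < F p by apply: F_gt0; lia.
  elim: q pq qm => [//|q IH] pq qm.
  have Fq : 0 < F q by apply: F_gt0; lia.
  rewrite -(pmulr_rgt0 _ Fq) d3_plucker.
  have Dpq : 0 <= d3 (X 0%N) (X p) (X q).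
    have [->|pq'] := eqVneq p q; first by rewrite d3_diag.
    by apply: ltW; apply: IH; lia.
  apply: ltr_wpDr; first by apply: mulr_ge0 => //; apply/ltW/F_gt0; lia.
  by apply: mulr_gt0 => //; apply: E_gt0; lia.
have shift p q l n : d3 (X (p + n)%N) (X (q + n)%N) (X (l + n)%N) = \det A ^+ n * d3 (X p) (X q) (X l).
  elim: n => [|n IH]; first by rewrite !addn0 expr0 mul1r.
  by rewrite !addnS !x_thetaS d3_mulmx IH exprS mulrA.
have dA : 0 < \det A.
  rewrite A_thetaE det_cols3 /d3 !mxE /=.
  rewrite (_ : _ + _ = r ^+ 2 * (cos theta ^+ 2 + sin theta ^+ 2)); last by ring.
  by rewrite cos2Dsin2 mulr1 exprn_gt0.
move=> ij jk km.
have := shift 0%N (j - i)%N (k - i)%N i; rewrite add0n !subnK; [|lia|lia] => ->.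
by rewrite mulr_gt0 ?exprn_gt0//; apply: D0; lia.
Qed.

End Theta.
End ThetaPoints.

(** * Cones over convex polygons at height 1 *)

Section Polygon.
Context {R : realType}.
Variables (m : nat) (x : nat -> 'cV[R]_3).
Hypothesis m4 : (4 <= m)%N.
Hypothesis xpos : forall i j k, (i < j)%N -> (j < k)%N -> (k < m)%N ->
  0 < d3 (x i) (x j) (x k).
Hypothesis x1 : forall i, x i 2%:R 0 = 1.

(** With [x_theta m theta] for [x] this is convertible to [K_theta m theta]. *)
Definition polygon_cone : set 'cV[R]_3 :=
  [set y | exists2 c : 'I_m -> R, (forall j, 0 <= c j) & y = \sum_j c j *: x j].

Notation K := polygon_cone.

Definition next i := if i.+1 == m then 0%N else i.+1.

(** The facet form of a side: zero on it and positive at the other vertices. *)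
Definition edge i y : R := d3 (x i) (x (next i)) y.

Lemma edge_gt0 i j : (i < m)%N -> (j < m)%N -> j != i -> j != next i -> 0 < edge i (x j).
Proof.
rewrite /edge /next => im jm ji; case: (i.+1 =P m) => [im1|/eqP im1] jn.
  by rewrite d3_rot; apply: xpos; lia.
have [ij|ij] := ltnP i j; first by apply: xpos; lia.
by rewrite -d3_rot; apply: xpos; lia.
Qed.

Lemma off_edge i : (i < m)%N -> exists k, [/\ (k < m)%N, k != i & k != next i].
Proof.
move=> im; rewrite /next; case: (i.+1 =P m) => [im1|/eqP im1]; first by exists 1%N; split; lia.
have [i0|i0] := eqVneq i 0%N; first by exists 2%N; split; lia.
have [i1|i1] := eqVneq i.+2 m; first by exists 0%N; split; lia.
by exists i.+2; split; lia.
Qed.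

Lemma edge_eq0 i j : (j == i) || (j == next i) -> edge i (x j) = 0.
Proof. by rewrite /edge => /orP[]/eqP ->; rewrite ?d3_diagl ?d3_diag. Qed.

Lemma edge_ge0 i j : (i < m)%N -> (j < m)%N -> 0 <= edge i (x j).
Proof.
move=> im jm; have [|] := boolP ((j == i) || (j == next i)).
  by move=> /edge_eq0 ->.
by rewrite negb_or => /andP[ji jn]; exact/ltW/edge_gt0.
Qed.

Lemma edge_sum i (c : 'I_m -> R) :
  edge i (\sum_j c j *: x j) = \sum_j c j * edge i (x j).
Proof.
rewrite /edge; elim/big_rec2 : _ => [|j y s _ IH]; first by rewrite /d3 !mxE; ring.
by rewrite d3Dr d3Zr IH.
Qed.

Lemma polygon_convex : convex_cone K.
Proof.
split=> [a z a0 [c c0 ->]|z w [c c0 ->] [d d0 ->]].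
  exists (fun i => a * c i) => [i|]; first by rewrite mulr_ge0.
  by rewrite scaler_sumr; apply: eq_bigr => i _; rewrite scalerA.
exists (fun i => c i + d i) => [i|]; first by rewrite addr_ge0.
by rewrite -big_split; apply: eq_bigr => i _; rewrite scalerDl.
Qed.

Lemma polygon_vertex i : (i < m)%N -> K (x i).
Proof.
move=> im; exists (fun j => if j == Ordinal im then 1 else 0) => [j|].
  by case: ifP.
rewrite (bigD1 (Ordinal im))//= eqxx scale1r big1 ?addr0// => j /negbTE ->.
exact: scale0r.
Qed.

(* Conversely, y lies in the triangle x 0, x j, x (j + 1) of the fan from x 0,
   where j is the last index with y to the left of the line from x 0 to x j. *)
Lemma polygonE y : K y <-> forall i, (i < m)%N -> 0 <= edge i y.
Proof.
have [KZ KD] := polygon_convex.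
split=> [[c c0 ->] i im|Hy].
  by rewrite edge_sum sumr_ge0// => j _; rewrite mulr_ge0// edge_ge0.
pose e j := d3 (x 0%N) (x j) y.
have m0 : (0 < m)%N by exact: leq_trans m4.
have e1 : 0 <= e 1%N.
  by have := Hy 0%N m0; rewrite /edge /next; case: (1%N =P m) => // mE; move: m4; rewrite -mE.
have ex : exists k, (1 < k < m)%N && (e k <= 0).
  exists m.-1; apply/andP; split; first lia.
  have := Hy m.-1; rewrite /edge /next prednK// eqxx => /(_ (leqnn m)).
  by rewrite d3_rot d3_swap oppr_ge0.
case: (ex_minnP ex) => k /andP[/andP[k1 km] ek] kmin.
case: k k1 km ek kmin => [//|k] k1 km ek kmin.
have ek0 : 0 <= e k.
  have [->//|k1'] := eqVneq k 1%N; rewrite leNgt; apply/negP => ekn.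
  by have := kmin k; rewrite ltnn ltW// andbT => H; have := H _; lia.
have D0 : 0 < d3 (x 0%N) (x k) (x k.+1) by apply: xpos.
have fk : 0 <= d3 y (x k) (x k.+1).
  have := Hy k (ltnW km); rewrite /edge /next; case: (k.+1 =P m) => [kE|_]; first lia.
  by rewrite [X in _ -> 0 <= X]d3_rot.
rewrite -[y]scale1r -(@mulVf _ (d3 (x 0%N) (x k) (x k.+1))) ?gt_eqF// -scalerA cramer3.
apply: (KZ); first by rewrite invr_ge0 ltW.
apply: (KD); [apply: (KD)|]; (apply: (KZ); last by apply: polygon_vertex; lia) => //.
by rewrite d3_swap oppr_ge0.
Qed.

Lemma edge_continuous i : continuous (edge i).
Proof.
have cc (a : R) k : continuous (fun y : 'cV[R]_3 => a * y k 0).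
  move=> y; apply: (@cvgMl_tmp _ _ _ (nbhs_filter _) (fun y : 'cV[R]_3 => y k 0)).
  exact: coord_continuous.
have -> : edge i = fun y => d3 (x i) (x (next i)) (delta_mx 0 0) * y 0 0
  + d3 (x i) (x (next i)) (delta_mx 1 0) * y 1 0
  + d3 (x i) (x (next i)) (delta_mx 2%:R 0) * y 2%:R 0.
  by apply/funext => y; rewrite /edge /d3 !mxE /=; ring.
move=> y; apply: (@cvgD _ _ _ _ (nbhs_filter y)); last exact: cc.
by apply: (@cvgD _ _ _ _ (nbhs_filter y)); exact: cc.
Qed.

Lemma polygon_closed : closed K.
Proof.
have -> : K = \bigcap_(i in `I_m) (edge i @^-1` [set t | 0 <= t]).
  by apply/seteqP; split=> y /=; rewrite polygonE.
apply: closed_bigI => i _.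
by apply: preimage_closed; [move=> y _; exact: edge_continuous|exact: closed_ge].
Qed.

(** An interior point dominates a vertex off side [i], where [edge i] is positive. Conversely,
    finitely many strict inequalities of continuous forms persist nearby. *)
Lemma polygon_interior y : K° y <-> forall i, (i < m)%N -> 0 < edge i y.
Proof.
split=> [Ky i im|Hy].
  have [k [km ki kn]] := off_edge im.
  have [e e0 /polygonE/(_ i im)] := interior_below (x k) Ky.
  rewrite -scaleNr /edge d3Dr d3Zr mulNr subr_ge0 => /(lt_le_trans _); apply.
  by rewrite mulr_gt0// edge_gt0.
have : \forall z \near y, forall i : 'I_m, 0 < edge i z.
  apply: (@filter_forall _ _ _ _ (nbhs_filter y)) => i; apply: (@edge_continuous i y [set t | 0 < t]).
  by apply: open_nbhs_nbhs; split; [exact: open_gt|exact: Hy].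
apply: (@filterS _ _ (nbhs_filter y)) => z Hz; apply/polygonE => i im; exact/ltW/(Hz (Ordinal im)).
Qed.

Lemma polygon_pointed : pointed_cone K.
Proof.
have K0 : K 0.
  by rewrite -(scale0r (x 0%N)); apply: (proj1 polygon_convex) => //; apply: polygon_vertex; lia.
apply/seteqP; split=> [y [Ky [_ [c c0 ->] yE]]|_ ->]; last first.
  by split=> //; exists 0 => //; rewrite oppr0.
have [d d0 dE] := Ky.
have coord (c' : 'I_m -> R) : (\sum_j c' j *: x j) 2%:R 0 = \sum_j c' j.
  by rewrite summxE; apply: eq_bigr => j _; rewrite mxE x1 mulr1.
have dc : \sum_j (d j + c j) = 0.
  by rewrite big_split /= -!coord -dE -yE mxE addNr.
have dj j : d j = 0.
  move/eqP: dc; rewrite psumr_eq0; last by move=> k _; rewrite addr_ge0.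
  by move=> /allP/(_ j); rewrite mem_index_enum paddr_eq0// => /(_ isT)/andP[/eqP ->].
by rewrite dE big1// => j _; rewrite dj scale0r.
Qed.

Lemma polygon_proper : proper_cone K.
Proof.
split; [exact: polygon_closed|exact: polygon_convex|exact: polygon_pointed|].
exists (\sum_(j < m) 1 *: x j); apply/polygon_interior => i im.
have [k [km ki kn]] := off_edge im.
rewrite edge_sum (bigD1 (Ordinal km))//= mul1r ltr_wpDr ?edge_gt0//.
by rewrite sumr_ge0// => j _; rewrite mul1r edge_ge0.
Qed.

(** No side contains both vertices, so each facet form is positive at one of them. *)
Lemma polygon_nonadjacent i j : (i < m)%N -> (j < m)%N ->
  i != j -> i != next j -> j != next i -> K° (x i + x j).
Proof.
move=> im jm ij inj jni; apply/polygon_interior => k km.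
rewrite /edge d3Dr -/(edge k _) -/(edge k _).
have [ik|ik] := boolP ((i == k) || (i == next k)); last first.
  by rewrite ltr_wpDr ?edge_ge0//; move: ik; rewrite negb_or => /andP[]; exact: edge_gt0.
rewrite ltr_wpDl ?edge_ge0//; case/orP: ik => /eqP ik.
  by apply: edge_gt0; rewrite -?ik// eq_sym.
apply: edge_gt0 => //; last by rewrite -ik eq_sym.
by apply: contraNneq inj => ->; rewrite ik.
Qed.

Lemma polygon_adjacent i k : (i < m)%N -> (k < m)%N ->
  below K (x k) (x i + x (next i)) -> k = i \/ k = next i.
Proof.
move=> im km [e e0 /polygonE/(_ i im)].
rewrite /edge !(d3Dr, =^~ scaleNr, d3Zr) d3_diagl d3_diag !add0r -/(edge i (x k)).
have [/orP[/eqP ->|/eqP ->]|] := boolP ((k == i) || (k == next i)); [by left|by right|].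
rewrite negb_or mulNr oppr_ge0 => /andP[ki kn].
by rewrite leNgt mulr_gt0// edge_gt0.
Qed.

(** The form of side [l] vanishes at [x i] and is nonnegative at [y] and [z], hence vanishes at [y];
    so no vertex off side [l] contributes to [y]. *)
Lemma polygon_split i l y z (c : 'I_m -> R) (j : 'I_m) : (l < m)%N ->
  (i == l) || (i == next l) -> (forall k, 0 <= c k) -> y = \sum_k c k *: x k ->
  K z -> x i = y + z -> val j != l -> val j != next l -> c j = 0.
Proof.
move=> lm il c0 yE /polygonE/(_ l lm) zl xE jl jn.
have := edge_eq0 il; rewrite xE /edge d3Dr -/(edge l y) -/(edge l z) => E.
have yl : edge l y = \sum_k c k * edge l (x k) by rewrite yE edge_sum.
have ge k : 0 <= c k * edge l (x k) by rewrite mulr_ge0// edge_ge0.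
have : \sum_k c k * edge l (x k) == 0.
  by rewrite eq_le sumr_ge0// andbT -yl; lra.
rewrite psumr_eq0// => /allP/(_ j); rewrite mem_index_enum => /(_ isT).
by rewrite mulf_eq0 => /orP[/eqP//|]; rewrite gt_eqF// edge_gt0.
Qed.

Lemma polygon_extreme i : (i < m)%N -> extreme_vector K (x i).
Proof.
move=> im; split.
- exact: polygon_vertex.
- by move=> xi0; have := x1 i; rewrite xi0 mxE => /esym/eqP; rewrite oner_eq0.
- have half y z : K y -> K z -> x i = y + z -> ray (x i) y.
    move=> [c c0 yE] Kz xE; exists (c (Ordinal im)); first exact: c0.
    rewrite yE (bigD1 (Ordinal im))//= big1 ?addr0// => j ji.
    suff -> : c j = 0 by rewrite scale0r.
    have [jn|jn] := eqVneq (val j) (next i); last first.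
      by apply: (polygon_split im _ c0 yE Kz xE) => //; rewrite eqxx.
    (* The side that ends at [i]; it excludes [x (next i)], the one vertex that the side starting at
       [i] leaves possible. *)
    pose l := if i == 0%N then m.-1 else i.-1.
    have [lm il] : (l < m)%N /\ i = next l.
      rewrite /l /next; case: (i =P 0%N) => [->|i0]; first by rewrite prednK ?eqxx; lia.
      by split; [lia|case: (i.-1.+1 =P m); lia].
    apply: (polygon_split lm _ c0 yE Kz xE); first by rewrite il eqxx orbT.
      rewrite jn /l /next; case: (i.+1 =P m) => im1; case: (i =P 0%N) => i0; lia.
    by rewrite -il.
  move=> y z Ky Kz xE; split; first exact: half Ky Kz xE.
  by apply: half Kz Ky _; rewrite addrC.
Qed.

Lemma polygon_ray_inj i j : (i < m)%N -> (j < m)%N -> ray (x i) (x j) -> i = j.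
Proof.
move=> im jm [a /= _ aE].
have a1 : a = 1 by have := x1 j; rewrite -aE mxE x1 mulr1.
move: aE; rewrite a1 scale1r => xE; apply/eqP; apply/negP => ij.
have jn : j = next i.
  apply/eqP; apply: contrapT => /negP jn.
  have := @edge_gt0 i j im jm _ jn; rewrite -xE edge_eq0 ?eqxx// ltxx eq_sym.
  by move=> H; apply: notF; apply: H; exact/negP.
have inx : i = next j.
  apply/eqP; apply: contrapT => /negP jn'.
  have := @edge_gt0 j i jm im _ jn'; rewrite xE edge_eq0 ?eqxx// ltxx.
  by move=> H; apply: notF; apply: H; exact/negP.
move: jn inx; rewrite /next; case: (i.+1 =P m); case: (j.+1 =P m); lia.
Qed.

Lemma polygon_frame : frame K (fun i : 'I_m => x i).
Proof.
split=> [i|i j rij|//]; first exact: polygon_extreme.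
by apply: val_inj; exact: polygon_ray_inj rij.
Qed.

Lemma polygon_polyhedral : polyhedral_cones m K.
Proof.
split; first exact: polygon_proper.
rewrite card_eq_sym; apply/card_set_bijP; exists (fun i => ray (x i)); split.
- by move=> i /= im; exists (x i) => //; exact: polygon_extreme.
- move=> i j; rewrite !inE /= => im jm rE; apply: polygon_ray_inj => //.
  by rewrite rE; exists 1 => //=; rewrite scale1r.
- move=> _ [y ey <-]; have [Ky y0 yext] := ey.
  have [i [e e0 Ke]] := frame_exists_below polygon_proper polygon_frame Ky y0.
  exists (val i); first exact: ltn_ord.
  apply/esym/(extreme_ray_eq ey (polygon_extreme (ltn_ord i))).
  have [] := yext (e *: x i) _ _ Ke.
  + by apply: (proj1 polygon_convex); [exact: ltW|exact: polygon_vertex].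
  + by rewrite subrKC.
  move=> [a /= a0 aE] _; exists (e^-1 * a); first by rewrite /= mulr_ge0// invr_ge0 ltW.
  by rewrite -scalerA aE scalerA mulVf ?scale1r// gt_eqF.
Qed.

End Polygon.

(** * Exponents of polyhedral cones and of A_theta *)

Section Exponents.
Context {R : realType}.
Implicit Types (K : set 'cV[R]_3) (A B : 'M[R]_3).

Lemma polyhedral_exponent_le m K A p : (2 < m)%N -> polyhedral_cones m K ->
  is_exponent K A p -> (p <= 2 * m - 1)%N.
Proof.
move=> m3 Km [Aprim _ minp]; apply: minp; have [Kproper _] := Km.
have [x Kx] := polyhedral_frame Km; exact: exponent_bound Kproper Aprim Kx.
Qed.

Lemma exponent_wielandt m K A : (2 < m)%N -> polyhedral_cones m K ->
  is_exponent K A (2 * m - 1) -> exists z a b, wielandt m K A z a b.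
Proof.
move=> m3 Km [Aprim _ minp]; have [Kproper _] := Km.
have [x Kx] := polyhedral_frame Km.
have [z [Kz z0 long]] : exists z, [/\ K z, z <> 0 & ~ K° (A ^+ (2 * m - 2) *m z)].
  apply: contrapT => nex; have := minp (2 * m - 2)%N.
  suff pint : power_into_interior K A (2 * m - 2) by move=> /(_ pint); lia.
  split=> [|z Kz z0]; first lia.
  by apply: contrapT => nz; apply: nex; exists z.
have [i [a [b W]]] := wielandt_of_long m3 Kproper Aprim Kx Kz z0 long.
by exists (x i), a, b.
Qed.

Lemma expn_scale_interior K A (c : R) q x : convex_cone K -> 0 < c ->
  K° ((c *: A) ^+ q *m x) <-> K° (A ^+ q *m x).
Proof.
move=> cK c0; have cq : 0 < c ^+ q by exact: exprn_gt0.
rewrite exprZn -scalemxAl; split; last exact: interior_scale.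
move=> /(@interior_scale _ _ _ (c ^+ q)^-1 _ cK); rewrite invr_gt0 => /(_ cq).
by rewrite scalerA mulVf ?scale1r// gt_eqF.
Qed.

Lemma exponent_scale K A (c : R) p : convex_cone K -> 0 < c ->
  is_exponent K A p -> is_exponent K (c *: A) p.
Proof.
move=> cK c0 [[AK [q Aq]] Ap minp].
have powE n : power_into_interior K (c *: A) n <-> power_into_interior K A n.
  split=> -[n0 Hn]; (split; first exact: n0) => x Kx x0.
    exact: (proj1 (expn_scale_interior A n x cK c0) (Hn x Kx x0)).
  exact: (proj2 (expn_scale_interior A n x cK c0) (Hn x Kx x0)).
split; last by move=> n /powE; exact: minp.
  split; last by exists q; apply/powE.
  by move=> x Kx; rewrite -scalemxAl; apply: (proj1 cK); [exact: ltW|exact: AK].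
exact/powE.
Qed.

Section Theta.
Variables (m : nat) (theta : R).
Hypotheses (m4 : (4 <= m)%N) (tw : window m theta).
Notation X := (x_theta m theta).
Notation A := (A_theta m theta).
Notation K := (K_theta m theta).
Notation a := (theta_a m theta).
Notation b := (theta_b m theta).

Let Xpos := @theta_d3_gt0 R m theta m4 tw.
Let X1 i : X i 2%:R 0 = 1. Proof. by rewrite mxE. Qed.
Let a0 : 0 < a. Proof. exact: theta_a_gt0. Qed.
Let b0 : 0 < b. Proof. exact: theta_b_gt0. Qed.

Lemma theta_polyhedral : polyhedral_cones m K.
Proof. exact: polygon_polyhedral. Qed.

Lemma theta_proper : proper_cone K.
Proof. by have [] := theta_polyhedral. Qed.

Let cK : convex_cone K. Proof. by have [] := theta_proper. Qed.

Lemma theta_preserving : cone_preserving K A.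
Proof.
move=> y [c c0 ->]; have [KZ KD] := cK.
rewrite mulmx_sumr; elim/big_ind : _ => [|u v|j _]; [exact: cone0 theta_proper|exact: KD|].
rewrite -scalemxAr -x_thetaS; apply: (KZ) => //.
have [jm|jm] := eqVneq j.+1 m; last by apply: polygon_vertex; rewrite ltn_neqAle jm ltn_ord.
rewrite jm (x_theta_wrap m4 tw); apply: KD; apply: KZ; rewrite ?ltW//.
  by apply: polygon_vertex; lia.
by apply: polygon_vertex; lia.
Qed.

Lemma theta_expn_X n k : A ^+ n *m X k = X (n + k)%N.
Proof.
elim: n => [|n IH]; first by rewrite expr0 mul1mx.
by rewrite exprS -mulmxE -mulmxA IH -x_thetaS.
Qed.

(** [X (2 * m - 1)] is [a] times [X m.-1] plus [b] times [X m], hence dominates the interior point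
    [X 1 + X m.-1]; one step earlier, [X (2 * m - 2)] is still on the side from [X m.-2] to
    [X m.-1]. *)
Lemma theta_exponent : is_exponent K A (2 * m - 1).
Proof.
have V i : (i < m)%N -> K (X i) by exact: polygon_vertex.
have AnK n : cone_preserving K (A ^+ n).
  move=> y Ky; elim: n => [|n IH]; first by rewrite expr0 mul1mx.
  by rewrite exprS -mulmxE -mulmxA; exact: theta_preserving.
have m0 : (0 < m)%N by exact: leq_trans m4.
have next_small i : (i.+1 < m)%N -> next m i = i.+1.
  by rewrite /next => im; case: (i.+1 =P m); lia.
have next_last : next m m.-1 = 0%N by rewrite /next prednK// eqxx.
have Kint1 : K° (X 1%N + X m.-1).
  apply: polygon_nonadjacent => //; [lia|lia|lia| |].
    by rewrite next_last.
  by rewrite next_small; lia.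
have Kint q : (2 * m - 1 <= q)%N -> K° (X q).
  elim: q => [|q IH]; first lia.
  rewrite leq_eqVlt => /orP[/eqP qE|].
    have -> : q.+1 = (m.-1 + m)%N by lia.
    rewrite -theta_expn_X (x_theta_wrap m4 tw) mulmxDr -!scalemxAr !theta_expn_X addn0.
    have -> : (m.-1 + 1 = m)%N by lia.
    rewrite (x_theta_wrap m4 tw); apply: (below_interior cK Kint1).
    have KX0 : K (X 0%N) by apply: V; lia.
    have KX1 : K (X 1%N) by apply: V; lia.
    have KXm : K (X m.-1) by apply: V; lia.
    have [KZ KD] := cK.
    have K1 : K (b *: (a *: X 0%N + b *: X 1%N)).
      by apply: (KZ); [exact: ltW|apply: KD; apply: (KZ) => //; exact: ltW].
    apply: below_addl => //.
      rewrite addrC; apply: below_add; [exact: cK| |exact: KZ (ltW a0) KXm].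
      apply: below_scaler; [exact: cK|exact: b0|].
      rewrite addrC; apply: below_add; [exact: cK| |exact: KZ (ltW a0) KX0].
      by apply: below_scaler; [exact: cK|exact: b0|exact: below_refl].
    apply: below_add; [exact: cK| |exact: K1].
    by apply: below_scaler; [exact: cK|exact: a0|exact: below_refl].
  (* An interior [X q] dominates [X 0 + X m.-2], so its image dominates [X 1 + X m.-1]. *)
  rewrite ltnS => /IH Kq; rewrite x_thetaS.
  have : below K (X 0%N + X m.-2) (X q) by exact: interior_below.
  move=> /(map_below theta_preserving); rewrite mulmxDr -!x_thetaS.
  have -> : m.-2.+1 = m.-1 by lia.
  exact: below_interior cK Kint1.
have Kedge : ~ K° (A ^+ (2 * m - 2) *m X 0%N).
  have -> : (2 * m - 2 = m.-2 + m)%N by lia.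
  rewrite theta_expn_X addn0 -theta_expn_X (x_theta_wrap m4 tw) mulmxDr -!scalemxAr !theta_expn_X.
  have -> : (m.-2 + 0)%N = m.-2 by rewrite addn0.
  have -> : (m.-2 + 1)%N = m.-1 by lia.
  have m2 : (m.-2 < m)%N by lia.
  move=> /(polygon_interior m4 Xpos)/(_ _ m2).
  rewrite /edge next_small; last by lia.
  have -> : m.-2.+1 = m.-1 by lia.
  by rewrite d3Dr !d3Zr d3_diagl d3_diag !mulr0 addr0 ltxx.
have pint : power_into_interior K A (2 * m - 1).
  split=> [|y Ky y0]; first lia.
  have [i iy] := frame_exists_below theta_proper (polygon_frame m4 Xpos X1) Ky y0.
  apply: (below_interior cK _ (map_below (@AnK _) iy)).
  by rewrite theta_expn_X; apply: Kint; rewrite leq_addr.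
have prim : primitive K A by split; [exact: theta_preserving|exists (2 * m - 1)%N].
split; [exact: prim|exact: pint|] => q [q0 Hq]; rewrite leqNgt; apply/negP => qm; apply: Kedge.
have KX0 : K (X 0%N) by apply: V; lia.
have X0 : X 0%N <> 0 by move=> E; have := X1 0%N; rewrite E mxE => /esym/eqP; rewrite oner_eq0.
apply: (primitive_interior_expn theta_proper prim _ _ (Hq _ KX0 X0)); first lia.
by exists (X 0%N).
Qed.

Lemma theta_cone_exponent : is_cone_exponent K (2 * m - 1).
Proof.
split; first by exists A; exact: theta_exponent.
move=> B p; apply: polyhedral_exponent_le theta_polyhedral; exact: ltnW.
Qed.

Lemma theta_trace : \tr A = 1 + 2 * r_theta m theta * cos theta.
Proof. by rewrite A_thetaE /mxtrace sum_ord3 !mxE /=; ring. Qed.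

Lemma theta_det : \det A = r_theta m theta ^+ 2.
Proof.
rewrite A_thetaE det_cols3 /d3 !mxE /= -[RHS]mulr1 -[X in _ = _ * X](cos2Dsin2 theta); ring.
Qed.

End Theta.
End Exponents.

(** * Uniqueness *)

Section FourEigenvectors.
Context {R : realFieldType}.
Implicit Types (A B C : 'M[R]_3).

(** The coordinates of [u 3] in the basis [u 0], [u 1], [u 2] are all nonzero, so comparing
    [C *m u 3] with [d 3 *: u 3] makes the four eigenvalues equal. *)
Lemma four_eigenvectors C (u : nat -> 'cV[R]_3) (d : nat -> R) :
  (forall i j k, (i < j)%N -> (j < k)%N -> (k < 4)%N -> d3 (u i) (u j) (u k) != 0) ->
  (forall i, (i < 4)%N -> C *m u i = d i *: u i) -> C = d 3 *: 1.
Proof.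
move=> D Cu; have D012 : d3 (u 0%N) (u 1%N) (u 2%N) != 0 by exact: D.
have := cramer3 (u 0%N) (u 1%N) (u 2%N) (u 3%N) => E.
have := congr1 (mulmx C) E.
rewrite !mulmxDr -!scalemxAr !Cu// => CE.
have := congr1 (fun v => d 3%N *: v) E; rewrite /= scalerA mulrC -scalerA CE => {CE}E'.
have {E'} : ((d 0%N - d 3%N) * d3 (u 3%N) (u 1%N) (u 2%N)) *: u 0%N
  + ((d 1%N - d 3%N) * d3 (u 0%N) (u 3%N) (u 2%N)) *: u 1%N
  + ((d 2%N - d 3%N) * d3 (u 0%N) (u 1%N) (u 3%N)) *: u 2%N = 0.
  apply/eqP; move/eqP: E'; rewrite -subr_eq0 => /eqP E'; rewrite -E'; apply/eqP.
  by apply/colP => i; rewrite !mxE; ring.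
have Dnz0 : d3 (u 3%N) (u 1%N) (u 2%N) != 0 by rewrite d3_rot; exact: D.
have Dnz1 : d3 (u 0%N) (u 3%N) (u 2%N) != 0 by rewrite d3_swap oppr_eq0; exact: D.
have Dnz2 : d3 (u 0%N) (u 1%N) (u 3%N) != 0 by exact: D.
move=> /(d3_free D012)[/eqP + /eqP + /eqP +].
rewrite !mulf_eq0 (negbTE Dnz0) (negbTE Dnz1) (negbTE Dnz2) !orbF !subr_eq0.
move=> /eqP e0 /eqP e1 /eqP e2.
by apply: (mulmx_eq3 D012); rewrite Cu// -scalemxAl mul1mx ?e0 ?e1 ?e2.
Qed.

(** Its first four values are at most 5: this is where [m >= 6] enters, leaving four vertices
    besides two exceptions. *)
Lemma avoid_two p q : exists f : nat -> nat,
  [/\ forall i j, (i < j)%N -> (f i < f j)%N, forall i, (f i <= i.+2)%N,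
      forall i, f i != p & forall i, f i != q].
Proof.
wlog pq : p q / (p <= q)%N.
  by move=> H; have [/H//|/ltnW/H[f [? ? ? ?]]] := leqP p q; exists f.
exists (fun i => if (i < p)%N then i else if (i.+1 < q)%N then i.+1 else i.+2).
split=> [i j ij|i|i|i].
- case: (ltnP i p) => ?; case: (ltnP j p) => ?; case: (ltnP i.+1 q) => ?;
    case: (ltnP j.+1 q) => ?; lia.
all: by case: (ltnP i p) => ?; case: (ltnP i.+1 q) => ?; lia.
Qed.

End FourEigenvectors.

(** * Exp-maximal pairs up to cone-equivalence *)

Section Main.
Context {R : realType}.
Implicit Types (K : set 'cV[R]_3) (A : 'M[R]_3).

Lemma window_exists m : (4 <= m)%N -> exists theta : R, window m theta.
Proof.
move=> m4; have pi0 := pi_gt0 R.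
have m1 : (0 < m.-1)%N by lia.
have [a b] : 0 < m.-1%:R :> R /\ 0 < m%:R :> R by rewrite !ltr0n; split; lia.
have lt : 2 * pi / m%:R < 2 * pi / m.-1%:R :> R.
  by rewrite ltr_pM2l ?mulr_gt0// ltf_pV2// ltr_nat; lia.
exists ((2 * pi / m%:R + 2 * pi / m.-1%:R) / 2); apply/windowP => //.
by rewrite in_itv /=; have [-> ->] := midf_lt lt.
Qed.

(** The similarity invariants [1 + 2 r cos theta] and [r ^+ 2] determine [r > 0] and then the angle
    between 0 and [pi]. *)
Lemma window_inj m (t u : R) : (4 <= m)%N -> window m t -> window m u ->
  \tr (A_theta m t) = \tr (A_theta m u) -> \det (A_theta m t) = \det (A_theta m u) ->
  t = u.
Proof.
move=> m4 tw uw; rewrite !theta_trace !theta_det => trE detE.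
have [rt _] := r_thetaP m4 tw; have [ru _] := r_thetaP m4 uw.
have rE : r_theta m t = r_theta m u.
  by apply/eqP; rewrite -(eqrXn2 (n := 2))// ?ltW//; apply/eqP.
have cE : cos t = cos u.
  apply: (@mulfI _ (2 * r_theta m t)); first by rewrite mulf_neq0// gt_eqF.
  by move: trE; rewrite -rE => /addrI.
have [/andP[t0 t1] _ _] := tw; have [/andP[u0 u1] _ _] := uw.
by apply: cos_inj cE; rewrite in_itv /= !ltW.
Qed.

(** Some [K_theta] attains the general bound [2 * m - 1], so a maximal cone must attain it too. *)
Lemma exp_maximal_exponent m K A : (4 <= m)%N -> exp_maximal_cone m K ->
  exp_maximal_matrix K A -> is_exponent K A (2 * m - 1).
Proof.
move=> m4 [Km [g Kg gmax]] [g' Kg' Ag'].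
have m3 : (2 < m)%N by exact: ltnW.
have [theta tw] := window_exists m4.
have gE : (2 * m - 1 <= g)%N.
  exact: gmax (theta_polyhedral m4 tw) (theta_cone_exponent m4 tw).
have [[B Bg] _] := Kg; have [_ g'max] := Kg'.
have gg' := g'max _ _ Bg; have g'le := polyhedral_exponent_le m3 Km Ag'.
by have <- : g' = (2 * m - 1)%N by lia.
Qed.

Lemma image_frame m K A P (theta : R) z : proper_cone K ->
  frame K (fun k : 'I_m => A ^+ k *m z) ->
  (forall k, P *m x_theta m theta k = A ^+ k *m z) ->
  [set P *m x | x in K_theta m theta] = K.
Proof.
move=> Kproper Kx PX; apply/seteqP; split=> [_ [y [c c0 ->] <-]|y Ky].
  rewrite mulmx_sumr; under eq_bigr do rewrite -scalemxAr PX.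
  have [_ cK _ _] := Kproper.
  apply: convex_sum => //; [exact: cone0 Kproper|exact: frameK Kx].
have [_ _ /(_ y Ky)[c c0 ->]] := Kx.
exists (\sum_j c j *: x_theta m theta j); first by exists c.
by rewrite mulmx_sumr; apply: eq_bigr => j _; rewrite -scalemxAr PX.
Qed.

Lemma exp_maximal_equivalent m K A : (4 <= m)%N ->
  exp_maximal_cone m K -> exp_maximal_matrix K A -> is_spectral_radius A 1 ->
  exists! theta : R, (theta \in `]2 * pi / m%:R, 2 * pi / m.-1%:R[) /\
    cone_equivalent K A (K_theta m theta) (A_theta m theta).
Proof.
move=> m4 Kmax Amax sr; have m3 : (2 < m)%N by exact: ltnW.
have Aexp := exp_maximal_exponent m4 Kmax Amax.
have [Km _] := Kmax; have [Kproper _] := Km.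
have [[AK _] _ _] := Aexp.
have [z [a [b W]]] := exponent_wielandt m3 Km Aexp.
have [_ [v Kv Av]] := wielandt_spectral_radius m3 Kproper W sr.
have [theta tw [P [Pu AP PX]]] := wielandt_theta m4 Kproper W Kv Av.
have [_ _ _ Kx _] := W.
have PE : invmx P *m A *m P = A_theta m theta by rewrite -mulmxA AP mulKmx.
exists theta; split.
  split; first exact/windowP.
  split=> //; first exact: theta_preserving.
  by exists P; split=> //; exact: image_frame Kproper Kx PX.
move=> theta' [/windowP-/(_ m4) tw' [_ _ [Q [Qu _ QE]]]].
have trE (T : 'M[R]_3) : T \in unitmx -> \tr (invmx T *m A *m T) = \tr A.
  by move=> Tu; rewrite mxtrace_mulC mulmxA mulmxV// mul1mx.
have detE (T : 'M[R]_3) : T \in unitmx -> \det (invmx T *m A *m T) = \det A.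
  by move=> Tu; rewrite !det_mulmx mulrAC -det_mulmx mulVmx// det1 mul1r.
by apply: (window_inj m4) => //; rewrite -PE -QE ?trE ?detE.
Qed.

(** * Exp-maximal matrices of K_theta *)

Section Uniqueness.
Variables (m : nat) (theta : R).
Hypotheses (m6 : (6 <= m)%N) (tw : window m theta).
Notation X := (x_theta m theta).
Notation K := (K_theta m theta).

Let m4 : (4 <= m)%N. Proof. exact: leq_trans m6. Qed.
Let Xpos := @theta_d3_gt0 R m theta m4 tw.
Let X1 i : X i 2%:R 0 = 1. Proof. by rewrite mxE. Qed.
Let Kproper : proper_cone K := theta_proper m4 tw.
Let cK : convex_cone K. Proof. by have [] := Kproper. Qed.

Let next_inj i j : (i < m)%N -> (j < m)%N -> next m i = next m j -> i = j.
Proof. by rewrite /next; case: (i.+1 =P m); case: (j.+1 =P m); lia. Qed.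

(* The linear isomorphism onto K_theta' shows that consecutive points of the
   orbit are adjacent vertices of K_theta. *)
Let adjacent_labels A z a b : wielandt m K A z a b ->
  exists2 s : nat -> nat, [/\ forall k, (k < m)%N -> (s k < m)%N,
      {in [pred k | (k < m)%N] &, injective s} &
      forall k, (k < m)%N -> exists2 c : R, 0 < c & A ^+ k *m z = c *: X (s k)] &
    forall k, (k.+1 < m)%N -> s k.+1 = next m (s k) \/ s k = next m (s k.+1).
Proof.
move=> W; have m3 : (2 < m)%N by exact: ltnW.
have m1 : (1 < m)%N by exact: ltnW.
have [_ _ _ Kx _] := W.
have KX := polygon_frame m4 Xpos X1.
have lab k : exists i, (k < m)%N -> (i < m)%N /\ exists2 c : R, 0 < c & A ^+ k *m z = c *: X i.
  have [km|km] := ltnP k m; last by exists 0%N.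
  have [ext rinj _] := Kx; have [Kk k0 kext] := ext (Ordinal km).
  have [i ik] := frame_exists_below Kproper KX Kk k0.
  exists (val i) => _; split; first exact: ltn_ord.
  have [e e0 Ke] := ik; have [] := kext (e *: X i) _ _ Ke.
  - by apply: (proj1 cK); [exact: ltW|exact: frameK KX i].
  - by rewrite subrKC.
  move=> [c /= c0 cE] _.
  have cp : 0 < c.
    rewrite lt_def c0 andbT; apply/eqP => c0'; move: cE; rewrite c0' scale0r => /esym/eqP.
    by rewrite scaler_eq0 gt_eqF//= => /eqP; exact: (frame_neq0 KX).
  exists (c^-1 * e); first by rewrite mulr_gt0// invr_gt0.
  by rewrite -scalerA -cE scalerA mulVf ?scale1r// gt_eqF.
have [s Hs] := choice lab.
have sm k : (k < m)%N -> (s k < m)%N by move=> /Hs[].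
have sE k : (k < m)%N -> exists2 c : R, 0 < c & A ^+ k *m z = c *: X (s k) by move=> /Hs[].
have sinj : {in [pred k | (k < m)%N] &, injective s}.
  move=> j k; rewrite !inE => jm km sjk.
  have [c c0 cE] := sE j jm; have [d d0 dE] := sE k km.
  have [_ rinj _] := Kx; suff : Ordinal jm = Ordinal km by move=> /(congr1 val).
  apply: rinj; exists (d / c); first by rewrite /= divr_ge0 ?ltW.
  by rewrite /= cE scalerA divfK ?gt_eqF// dE sjk.
exists s => // k km.
have [t [t0 _] [v Kv Av]] := wielandt_eigenvector m1 Kproper W.
have Av' : (t *: A) *m v = v by rewrite -scalemxAl.
(* [P] carries some [K_theta'] onto [K], and its vertices in cyclic order to the orbit of [z] under
   [t *: A]. *)
have [theta' tw' [P [Pu AP PX]]] :=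
  wielandt_theta m4 Kproper (wielandt_scale m1 Kproper t0 W) Kv Av'.
have [_ _ _ Kx' _] := wielandt_scale m1 Kproper t0 W.
have PK := image_frame Kproper Kx' PX.
have km' : (k < m)%N by exact: ltnW.
have nk : next m k = k.+1 by rewrite /next; case: (k.+1 =P m); lia.
(* If the labels were not adjacent, the sum of the two orbit points would be interior to [K] and
   dominate the images of all vertices of [K_theta'], although it comes from a side. *)
apply: contrapT => /not_orP[n1 n2].
have adj l : (l < m)%N -> below K (P *m x_theta m theta' l)
    (P *m (x_theta m theta' k + x_theta m theta' k.+1)) -> l = k \/ l = k.+1.
  move=> lm [e e0]; rewrite scalemxAr -mulmxBr -{1}PK => -[y Ky /(can_inj (mulKmx Pu)) yE].
  rewrite -nk; apply: (polygon_adjacent m4 (theta_d3_gt0 m4 tw') km' lm).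
  by exists e => //; rewrite nk -yE.
have int : K° (P *m (x_theta m theta' k + x_theta m theta' k.+1)).
  rewrite mulmxDr !PX !exprZn -!scalemxAl.
  have [c c0 ->] := sE k km'; have [d d0 ->] := sE k.+1 km.
  have Xk : K (X (s k)) by apply: polygon_vertex; exact: sm.
  have Xk1 : K (X (s k.+1)) by apply: polygon_vertex; exact: sm.
  have Kint : K° (X (s k) + X (s k.+1)).
    apply: (polygon_nonadjacent m4 Xpos); [exact: sm|exact: sm| |exact/eqP|exact/eqP].
    by apply/eqP => /sinj; rewrite !inE => /(_ km' km); lia.
  rewrite !scalerA; apply: (below_interior cK Kint).
  have p1 : 0 < t ^+ k * c by rewrite mulr_gt0// exprn_gt0.
  have p2 : 0 < t ^+ k.+1 * d by rewrite mulr_gt0// exprn_gt0.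
  apply: below_addl => //; last rewrite addrC; apply: below_add => //.
  - by apply: below_scaler => //; exact: below_refl.
  - by apply: (proj1 cK) => //; exact: ltW.
  - by apply: below_scaler => //; exact: below_refl.
  - by apply: (proj1 cK) => //; exact: ltW.
have [l [lm lk lk1]] := off_edge m4 km'.
by have [] := adj l lm (interior_below _ int); move: lk lk1; rewrite nk; lia.
Qed.

Let eigen4 C (d : nat -> R) p q :
  (forall i, (i < m)%N -> i != p -> i != q -> C *m X i = d i *: X i) ->
  exists2 i, [/\ (i < m)%N, i != p & i != q] & C = d i *: 1.
Proof.
move=> CX; have [f [fmono f2 fp fq]] := avoid_two p q.
have fm i : (i < 4)%N -> (f i < m)%N by have := f2 i; lia.
exists (f 3); first by split; rewrite ?fm.
apply: (@four_eigenvectors R C (fun i => X (f i)) (fun i => d (f i))).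
  move=> i j k ij jk k4; rewrite gt_eqF//; apply: Xpos; [exact: fmono|exact: fmono|exact: fm].
by move=> i i4; apply: CX => //; exact: fm.
Qed.

Lemma wielandt_unique A z a b : wielandt m K A z a b ->
  exists2 c : R, 0 < c & A = c *: A_theta m theta.
Proof.
move=> W; have [s [sm sinj sE] sadj] := adjacent_labels W.
have m0 : (0 < m)%N by lia.
have [r0 _] := r_thetaP m4 tw.
have Tu : A_theta m theta \in unitmx.
  by rewrite unitmxE unitfE theta_det expf_neq0// gt_eqF.
have ssurj i : (i < m)%N -> exists2 k, (k < m)%N & i = s k.
  move=> im; pose g (k : 'I_m) : 'I_m := Ordinal (sm k (ltn_ord k)).
  have ginj : injective g.
    move=> j k /(congr1 val) /= /sinj jk; apply: val_inj; apply: jk; rewrite inE; exact: ltn_ord.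
  have [h _ gh] := injF_bij ginj; exists (h (Ordinal im)); first exact: ltn_ord.
  by have := congr1 val (gh (Ordinal im)).
have Tnext i : (i < m)%N -> i != m.-1 -> A_theta m theta *m X i = X (next m i).
  move=> im im1; rewrite -x_thetaS /next; case: (i.+1 =P m) => //; lia.
have step k : (k.+1 < m)%N -> exists2 c : R, 0 < c & A *m X (s k) = c *: X (s k.+1).
  move=> km; have [c c0 cE] := sE k (ltnW km); have [d d0 dE] := sE k.+1 km.
  exists (c^-1 * d); first by rewrite mulr_gt0// invr_gt0.
  have -> : X (s k) = c^-1 *: (A ^+ k *m z) by rewrite cE scalerA mulVf ?scale1r// gt_eqF.
  by rewrite -scalemxAr mulmxA mulmxE -exprS dE scalerA.
have sneq k : (k.+2 < m)%N -> s k <> s k.+2.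
  by move=> km /sinj; rewrite !inE => H; have := H _ _; lia.
(* A change of direction would give [s k = s k.+2]. *)
have [fwd|bwd] : (forall k, (k.+1 < m)%N -> s k.+1 = next m (s k)) \/
    (forall k, (k.+1 < m)%N -> s k = next m (s k.+1)).
  have [f0|b0] := sadj 0%N (leq_trans (isT : 1 < 6)%N m6).
    left; elim=> [//|k IH] km; have [//|E] := sadj k.+1 km.
    have := IH (ltnW km); rewrite E => /next_inj H; case: (sneq k km); apply/esym.
    by apply: H; apply: sm; lia.
  right; elim=> [//|k IH] km; have [E|//] := sadj k.+1 km.
  by case: (sneq k km); rewrite E; apply: IH; exact: ltnW.
- have Hd i : exists c : R, (i < m)%N -> i != s m.-1 -> 0 < c /\ A *m X i = c *: X (next m i).
    have [im|im] := ltnP i m; last by exists 0.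
    have [k km iE] := ssurj i im; have [km1|km1] := eqVneq k m.-1.
      by exists 0 => _; rewrite iE km1 eqxx.
    have km2 : (k.+1 < m)%N by lia.
    have [c c0 cE] := step k km2; exists c => _ _; split=> //.
    by rewrite iE cE fwd.
  have [d dP] := choice Hd.
  (* Both matrices send [X i] to a positive multiple of the next vertex unless [i] is [m.-1] or
     [s m.-1]. *)
  have [|i [im ip iq] CE] := @eigen4 (invmx (A_theta m theta) *m A) d m.-1 (s m.-1).
    move=> i im ip iq; have [_ E] := dP i im iq.
    by rewrite -mulmxA E -Tnext// -scalemxAr mulKmx.
  exists (d i); first by have [] := dP i im iq.
  by rewrite -[A](mulKVmx Tu) CE -scalemxAr mulmx1.
- have Hd i : exists c : R, (i < m)%N -> i != s 0%N -> 0 < c /\ A *m X (next m i) = c *: X i.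
    have [im|im] := ltnP i m; last by exists 0.
    have [k km iE] := ssurj i im; case: k km iE => [|k] km iE.
      by exists 0 => _; rewrite iE eqxx.
    have [c c0 cE] := step k km; exists c => _ _; split=> //.
    by rewrite iE -bwd.
  have [d dP] := choice Hd.
  have [|i [im ip iq] CE] := @eigen4 (A *m A_theta m theta) d m.-1 (s 0%N).
    by move=> i im ip iq; have [_ E] := dP i im iq; rewrite -mulmxA Tnext.
  have [c0 _] := dP i im iq; set c := d i in c0 CE.
  have [_ _ _ KA _] := W.
  have AX j : (j < m)%N -> K (A *m X j).
    move=> jm; have [k km ->] := ssurj j jm; have [e e0 eE] := sE k km.
    have -> : X (s k) = e^-1 *: (A ^+ k *m z) by rewrite eE scalerA mulVf ?scale1r// gt_eqF.
    rewrite -scalemxAr mulmxA mulmxE -exprS; apply: (proj1 cK); first by rewrite invr_ge0 ltW.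
    have [km1|km1] := ltnP k.+1 m; first exact: frameK KA (Ordinal km1).
    have -> : k.+1 = m by lia.
    have [a0 b0 -> _ _] := W; apply: (proj2 cK); apply: (proj1 cK); rewrite ?ltW//.
      by have := frameK KA (Ordinal m0); rewrite expr0 mul1mx.
    have m1 : (1 < m)%N by lia.
    by have := frameK KA (Ordinal m1); rewrite expr1.
  (* Apply [A *m A_theta m theta = c *: 1] to [X m.-1]. Extremality of [X m.-1] then forces
     [A *m X 0] and [A *m X 1] onto its ray, against the injectivity of [A]. *)
  have lastE : c *: X m.-1 = theta_a m theta *: (A *m X 0%N) + theta_b m theta *: (A *m X 1%N).
    have := congr1 (mulmx^~ (X m.-1)) CE.
    rewrite /= -mulmxA -x_thetaS prednK// x_theta_wrap// mulmxDr -!scalemxAr => ->.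
    by rewrite -scalemxAl mul1mx.
  have m1 : (m.-1 < m)%N by lia.
  have [_ _ ext] := polygon_extreme m4 Xpos X1 m1.
  have Ainj w : A *m w = 0 -> w = 0.
    have /mulmx1C TA : A *m (c^-1 *: A_theta m theta) = 1%:M.
      by rewrite -scalemxAr CE scalerA mulVf ?gt_eqF// scale1r.
    by move=> Aw; rewrite -[w]mul1mx -TA -mulmxA Aw mulmx0.
  have onray e j (e0 : 0 < e) : ray (X m.-1) (e *: (A *m X j)) ->
      exists f : R, A *m X j = f *: X m.-1.
    move=> [f _ fE]; exists (e^-1 * f).
    by rewrite -scalerA fE scalerA mulVf ?scale1r// gt_eqF.
  have ta0 := theta_a_gt0 m4 tw; have tb0 := theta_b_gt0 m4 tw.
  have Ka : K ((theta_a m theta / c) *: (A *m X 0%N)).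
    by apply: (proj1 cK); [rewrite divr_ge0 ?ltW|apply: AX].
  have Kb : K ((theta_b m theta / c) *: (A *m X 1%N)).
    by apply: (proj1 cK); [rewrite divr_ge0 ?ltW|apply: AX; lia].
  have cn : c != 0 by rewrite gt_eqF.
  have [|ra rb] := ext _ _ Ka Kb.
    have := congr1 (fun w => c^-1 *: w) lastE.
    by rewrite /= scalerA mulVf// scale1r scalerDr !scalerA ![c^-1 * _]mulrC.
  have [|f fE] := onray _ _ _ ra; first exact: divr_gt0.
  have [|g gE] := onray _ _ _ rb; first exact: divr_gt0.
  have D0 : d3 (X 0%N) (X 1%N) (X 2%N) != 0 by rewrite gt_eqF// Xpos//; lia.
  have /Ainj : A *m (g *: X 0%N + (- f) *: X 1%N + 0 *: X 2%N) = 0.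
    rewrite scale0r addr0 mulmxDr -!scalemxAr fE gE !scalerA -scalerDl.
    by rewrite mulNr mulrC subrr scale0r.
  move=> /(d3_free D0)[_ /eqP + _]; rewrite oppr_eq0 => /eqP f0.
  have /Ainj X00 : A *m X 0%N = 0 by rewrite fE f0 scale0r.
  by have := X1 0%N; rewrite X00 mxE => /esym/eqP; rewrite oner_eq0.
Qed.

End Uniqueness.
End Main.

Theorem theorem8p6 (R : realType) (m : nat) (hm : (4 <= m)%N) :
  (forall (K : set 'cV[R]_3) (A : 'M[R]_3),
     exp_maximal_cone m K ->
     exp_maximal_matrix K A ->
     is_spectral_radius A 1 ->
     exists! theta : R,
       (theta \in `]2 * pi / m%:R, 2 * pi / m.-1%:R[) /\
       cone_equivalent K A (K_theta m theta) (A_theta m theta))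
  /\
  ((6 <= m)%N ->
   forall theta : R, theta \in `]2 * pi / m%:R, 2 * pi / m.-1%:R[ ->
   forall A : 'M[R]_3,
     exp_maximal_matrix (K_theta m theta) A <->
     exists2 c : R, 0 < c & A = c *: A_theta m theta).
Proof.
split=> [K A Kmax Amax sr|m6 theta]; first exact: exp_maximal_equivalent.
move=> /(windowP _ hm) tw A; have Km := theta_polyhedral hm tw.
have [Kproper _] := Km; have [_ cK _ _] := Kproper.
have Kexp := theta_cone_exponent hm tw.
split=> [[g Kg Ag]|[c c0 ->]].
  have gle := polyhedral_exponent_le (ltnW hm) Km Ag.
  have leg := (proj2 Kg) _ _ (theta_exponent hm tw).
  have gE : g = (2 * m - 1)%N by lia.
  rewrite gE in Ag; have [z [a [b W]]] := exponent_wielandt (ltnW hm) Km Ag.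
  exact: (wielandt_unique m6 tw W).
exists (2 * m - 1)%N => //; apply: exponent_scale => //; exact: theta_exponent.
Qed.
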